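(* (Composition-Diamond lemma for dialgebras.) Let $k$ be a field, $X$ a well ordered set, $D(X)$ the free dialgebra over $k$ generated by $X$, with the deg-lex ordering $<$ on the set $[X^*]$ of normal diwords. Let $S\subset D(X)$ be a set of monic polynomials and let $Id(S)$ be the ideal of $D(X)$ generated by $S$. Consider the following statements. (i) $S$ is a Gröbner–Shirshov basis in $D(X)$. (ii) For every nonzero $f\in Id(S)$, the leading term satisfies $[\overline{f}]=[a[\overline{s}]b]$ for some $s\in S$, $a,b\in X^*$ and some normal $s$-diword $[asb]$. (ii)$'$ Every $f\in Id(S)$ can be written as a (possibly empty) finite sum $f=\alpha_1[a_1s_1b_1]+\alpha_2[a_2s_2b_2]+\cdots+\alpha_n[a_ns_nb_n]$ with $\alpha_i\in k$, $s_i\in S$, $a_i,b_i\in X^*$, each $[a_is_ib_i]$ a normal $s_i$-diword, and $[a_1[\overline{s_1}]b_1]>[a_2[\overline{s_2}]b_2]>\cdots>[a_n[\overline{s_n}]b_n]$. (iii) The set $Irr(S)$ is a $k$-linear basis of the dialgebra $D(X|S)=D(X)/Id(S)$ (that is, the images of the elements of $Irr(S)$ are pairwise distinct and form a basis). Then (i) $\Rightarrow$ (ii) $\Leftrightarrow$ (ii)$'$ $\Leftrightarrow$ (iii).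
   Context: Dialgebras. A dialgebra over a field $k$ is a $k$-vector space $D$ with two bilinear associative products $\vdash,\dashv$ such that $a\dashv(b\vdash c)=a\dashv b\dashv c$, $(a\dashv b)\vdash c=a\vdash b\vdash c$, $a\vdash(b\dashv c)=(a\vdash b)\dashv c$ for all $a,b,c$. An ideal is a subspace closed under left and right multiplication by arbitrary elements for both products; $Id(S)$ is the ideal generated by $S$. Free dialgebra. $X^*$ is the free monoid on $X$. The free dialgebra $D(X)$ has as $k$-basis the set $[X^*]$ of normal diwords, i.e. nonempty words with one marked letter (the center), $[u]=x_{-m}\cdots x_{-1}\dot{x_0}x_1\cdots x_n$ ($m,n\ge 0$, $x_i\in X$), which stands for $x_{-m}\vdash\cdots\vdash x_{-1}\vdash x_0\dashv x_1\dashv\cdots\dashv x_n$. $[u]\vdash[v]$ is the concatenation $uv$ with the center of $[v]$, and $[u]\dashv[v]$ is $uv$ with the center of $[u]$. $|[u]|=m+n+1$ is the length. Ordering. $wt([u])=(n+m+1,m,x_{-m},\ldots,x_0,\ldots,x_n)$, and $[u]<[v]$ iff $wt([u])<wt([v])$ lexicographically. For $0\ne f\in D(X)$, $[\overline f]$ is the largest normal diword occurring in $f$ with nonzero coefficient (the leading term), $\overline f$ its underlying word, and $deg(f)=|[\overline f]|$; $f$ is monic if the coefficient of $[\overline f]$ is $1$. A polynomial $f$ is left normed if all normal diwords occurring in it have the form $u\dot x$ (center is the last letter), right normed if all have the form $\dot x u$ (center is the first letter), $u\in X^*$, $x\in X$. $s$-diwords. For a nonzero $s\in D(X)$, an $s$-diword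 is $[asb]=x_{-m}\vdash\cdots\vdash x_{-1}\vdash x_0\dashv x_1\dashv\cdots\dashv x_n|_{x_p\mapsto s}$ for some $m,n\ge0$, $-m\le p\le n$, $x_i\in X$, where $a=x_{-m}\cdots x_{p-1}$ and $b=x_{p+1}\cdots x_n$ (possibly empty); the notation $[asb]$ includes the choice of the position $0$ of the center. $[a[\overline s]b]$ denotes the normal diword obtained by the same expression with $s$ replaced by $[\overline s]$. $[asb]$ is a normal $s$-diword if $p=0$, or $p<0$ and $s$ is left normed, or $p>0$ and $s$ is right normed. A normal $s$-diword $[asb]$ is a left (right) normed $s$-diword if both $s$ and the polynomial $[asb]$ are left (right) normed. An $S$-diword is an $s$-diword with $s\in S$. Compositions of monic $f,g\in D(X)$. (1) If $f$ is not right normed and $x\in X$, $x\dashv f$ is a composition of left multiplication; if $f$ is not left normed and $x\in X$, $f\vdash x$ is a composition of right multiplication. (2) Inclusion: if $[w]=[\overline f]=[a[\overline g]b]$ with $[agb]$ a normal $g$-diword, $(f,g)_{[w]}=f-[agb]$. (3) Intersection: if $[w]=[[\overline f]b]=[a[\overline g]]$ with $|\overline f|+|\overline g|>|w|$, $[fb]$ a normal $f$-diword and $[ag]$ a normal $g$-diword, $(f,g)_{[w]}=[fb]-[ag]$. Triviality. For a set $S$ of monic polynomials: $x\dashv f$ (resp. $f\vdash x$) is trivial modulo $S$ if it equals a finite sum $\sum\alpha_i[a_is_ib_i]$ with $\alpha_i\in k$, $s_i\in S$, each $[a_is_ib_i]$ a right normed (resp. left normed) $s_i$-diword and $|[a_i[\overline{s_i}]b_i]|\le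 deg(x\dashv f)$ (resp. $\le deg(f\vdash x)$); the zero composition is trivial (empty sum). $(f,g)_{[w]}$ is trivial modulo $(S,[w])$ if it equals a finite sum $\sum\alpha_i[a_is_ib_i]$ with $\alpha_i\in k$, $s_i\in S$, each $[a_is_ib_i]$ a normal $s_i$-diword with $[a_i[\overline{s_i}]b_i]<[w]$, and moreover each $[a_is_ib_i]$ is a right (left) normed $s_i$-diword whenever both $f$ and $[agb]$ (inclusion case), or both $[fb]$ and $[ag]$ (intersection case), are right (left) normed $S$-diwords. $S$ is a Gröbner–Shirshov basis in $D(X)$ if all compositions of elements of $S$ are trivial. $Irr(S)=\{[u]\in[X^*] : [u]\neq[a[\overline s]b]$ for all $s\in S$, $a,b\in X^*$ and normal $s$-diwords $[asb]\}$. *)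

(* Defs.v *)
From HB Require Import structures.
From mathcomp Require Import all_boot all_order all_algebra finmap.
From mathcomp Require Import boolp classical_sets wochoice monalg.

Set Implicit Arguments.
Unset Strict Implicit.
Unset Printing Implicit Defensive.

Import Order.TTheory GRing.Theory.
Local Open Scope classical_set_scope.
Local Open Scope ring_scope.

Reserved Notation "x ⊢ y" (at level 40, left associativity).
Reserved Notation "x ⊣ y" (at level 40, left associativity).

HB.mixin Record Lmodule_isDialgebra (k : fieldType) V of GRing.Lmodule k V := {
  vdash : V -> V -> V;
  dashv : V -> V -> V;
  vdash_linearl : forall z, linear (vdash^~ z);
  vdash_linearr : forall z, linear (vdash z);
  dashv_linearl : forall z, linear (dashv^~ z);
  dashv_linearr : forall z, linear (dashv z);
  vdashA : associative vdash;
  dashvA : associative dashv;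
  dashv_vdash : forall a b c, dashv a (vdash b c) = dashv (dashv a b) c;
  vdash_dashv : forall a b c, vdash (dashv a b) c = vdash (vdash a b) c;
  vdashAdashv : forall a b c, vdash a (dashv b c) = dashv (vdash a b) c
}.

#[short(type="dialgType")]
HB.structure Definition Dialgebra (k : fieldType) :=
  {V of GRing.Lmodule k V & Lmodule_isDialgebra k V}.

Notation "x ⊢ y" := (vdash x y) : ring_scope.
Notation "x ⊣ y" := (dashv x y) : ring_scope.

Section Ideals.
Context {k : fieldType} {V : dialgType k}.
Implicit Types I S : set V.

Record is_ideal I : Prop := IsIdeal {
  ideal0 : I 0;
  idealD : forall f g, I f -> I g -> I (f + g);
  idealZ : forall (a : k) f, I f -> I (a *: f);
  ideal_vdashl : forall f g, I f -> I (g ⊢ f);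
  ideal_vdashr : forall f g, I f -> I (f ⊢ g);
  ideal_dashvl : forall f g, I f -> I (g ⊣ f);
  ideal_dashvr : forall f g, I f -> I (f ⊣ g)
}.

Definition gen_ideal S : set V :=
  [set f | forall I, is_ideal I -> S `<=` I -> I f].

Lemma gen_ideal_ideal S : is_ideal (gen_ideal S).
Proof.
split=> [I idI _|f g If Ig I idI SI|a f If I idI SI|f g If I idI SI
  |f g If I idI SI|f g If I idI SI|f g If I idI SI].
- exact: ideal0.
- by apply: idealD => //; [apply: If|apply: Ig].
- by apply: idealZ => //; apply: If.
- by apply: ideal_vdashl => //; apply: If.
- by apply: ideal_vdashr => //; apply: If.
- by apply: ideal_dashvl => //; apply: If.
- by apply: ideal_dashvr => //; apply: If.
Qed.

Lemma sub_gen_ideal S : S `<=` gen_ideal S.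
Proof. by move=> f Sf I _; apply. Qed.

Definition gen_idealp S : {pred V} := fun f => `[< gen_ideal S f >].

Lemma gen_idealpP S f : reflect (gen_ideal S f) (f \in gen_idealp S).
Proof. exact: asboolP. Qed.

Fact gen_idealp_zmod_closed S : zmod_closed (gen_idealp S).
Proof.
have idS := gen_ideal_ideal S.
split; first by apply/gen_idealpP; apply: (ideal0 idS).
move=> f g /gen_idealpP Sf /gen_idealpP Sg; apply/gen_idealpP.
by apply: (idealD idS) => //; rewrite -scaleN1r; apply: (idealZ idS).
Qed.

HB.instance Definition _ S :=
  GRing.isZmodClosed.Build V (gen_idealp S) (gen_idealp_zmod_closed S).

End Ideals.

(* The quotient dialgebra V / Id(S); its additive structure is the one of
   Quotient.quot. *)
Section QuotientDialgebra.
Context {k : fieldType} {V : dialgType k}.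
Variable S : set V.

Definition dialg_quot := Quotient.quot (gen_idealp S).

HB.instance Definition _ := Choice.on dialg_quot.
HB.instance Definition _ := GRing.Zmodule.on dialg_quot.

Definition dialg_pi (f : V) : dialg_quot := (\pi_(Quotient.quot (gen_idealp S)) f)%qT.
Definition dialg_repr (x : dialg_quot) : V :=
  repr (x : Quotient.quot (gen_idealp S)).

Lemma dialg_reprK x : dialg_pi (dialg_repr x) = x.
Proof. exact: (@reprK _ (Quotient.quot (gen_idealp S)) x). Qed.

Lemma dialg_piB : {morph dialg_pi : f g / f - g}.
Proof. exact: raddfB. Qed.

Lemma dialg_piD : {morph dialg_pi : f g / f + g}.
Proof. exact: raddfD. Qed.

Lemma dialg_piP f g : dialg_pi f = dialg_pi g <-> gen_ideal S (f - g).
Proof.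
split=> [E|H].
  apply/gen_idealpP; rewrite Quotient.idealrBE; exact/eqP.
apply/eqP; move/gen_idealpP: H; by rewrite Quotient.idealrBE.
Qed.

Lemma dialg_pi_eq0 f : dialg_pi f = 0 <-> gen_ideal S f.
Proof.
have -> : 0 = dialg_pi 0 by rewrite /dialg_pi raddf0.
by rewrite dialg_piP subr0.
Qed.

Lemma dialg_repr_pi f : gen_ideal S (dialg_repr (dialg_pi f) - f).
Proof. by apply/dialg_piP; rewrite dialg_reprK. Qed.

Definition quot_scale (a : k) (x : dialg_quot) := dialg_pi (a *: dialg_repr x).
Definition quot_vdash (x y : dialg_quot) := dialg_pi (dialg_repr x ⊢ dialg_repr y).
Definition quot_dashv (x y : dialg_quot) := dialg_pi (dialg_repr x ⊣ dialg_repr y).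

Let idS := gen_ideal_ideal S.

Lemma pi_scale a f : quot_scale a (dialg_pi f) = dialg_pi (a *: f).
Proof.
apply/dialg_piP; rewrite -scalerBr; apply: (idealZ idS); exact: dialg_repr_pi.
Qed.

Let bilinB (op : V -> V -> V) (opl : forall z, linear (op^~ z))
  (opr : forall z, linear (op z)) f f' g g' :
  op f' g' - op f g = op (f' - f) g' + op f (g' - g).
Proof.
have Bl x y z : op (x - y) z = op x z - op y z.
  by rewrite addrC -scaleN1r opl scaleN1r addrC.
have Br x y z : op z (x - y) = op z x - op z y.
  by rewrite addrC -scaleN1r opr scaleN1r addrC.
by rewrite Bl Br addrA subrK.
Qed.

Lemma pi_vdash f g : quot_vdash (dialg_pi f) (dialg_pi g) = dialg_pi (f ⊢ g).
Proof.
apply/dialg_piP; rewrite (bilinB vdash_linearl vdash_linearr).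
by apply: (idealD idS); [apply: (ideal_vdashr idS)|apply: (ideal_vdashl idS)];
  apply: dialg_repr_pi.
Qed.

Lemma pi_dashv f g : quot_dashv (dialg_pi f) (dialg_pi g) = dialg_pi (f ⊣ g).
Proof.
apply/dialg_piP; rewrite (bilinB dashv_linearl dashv_linearr).
by apply: (idealD idS); [apply: (ideal_dashvr idS)|apply: (ideal_dashvl idS)];
  apply: dialg_repr_pi.
Qed.

Let piE := (dialg_piD, pi_scale, pi_vdash, pi_dashv).
Let elim_pi (P : dialg_quot -> Prop) : (forall f, P (dialg_pi f)) -> forall x, P x.
Proof. by move=> H x; rewrite -[x]dialg_reprK. Qed.

Fact quot_scaleA a b x : quot_scale a (quot_scale b x) = quot_scale (a * b) x.
Proof. by elim/elim_pi: x => f; rewrite !pi_scale scalerA. Qed.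
Fact quot_scale1 : left_id 1 quot_scale.
Proof. by elim/elim_pi=> f; rewrite pi_scale scale1r. Qed.
Fact quot_scaleDr : right_distributive quot_scale +%R.
Proof.
by move=> a; elim/elim_pi=> f; elim/elim_pi=> g;
  rewrite -dialg_piD !pi_scale -dialg_piD scalerDr.
Qed.
Fact quot_scaleDl x : {morph quot_scale^~ x : a b / a + b}.
Proof.
by elim/elim_pi: x => f a b; rewrite !pi_scale -dialg_piD scalerDl.
Qed.
HB.instance Definition _ := GRing.Zmodule_isLmodule.Build k dialg_quot
  quot_scaleA quot_scale1 quot_scaleDr quot_scaleDl.

Lemma dialg_piZ a f : dialg_pi (a *: f) = a *: dialg_pi f.
Proof. exact/esym/pi_scale. Qed.

Fact quot_vdash_linearl z : linear (quot_vdash^~ z).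
Proof.
elim/elim_pi: z => h a; elim/elim_pi=> f; elim/elim_pi=> g.
by rewrite -dialg_piZ -dialg_piD !pi_vdash vdash_linearl dialg_piD dialg_piZ.
Qed.
Fact quot_vdash_linearr z : linear (quot_vdash z).
Proof.
elim/elim_pi: z => h a; elim/elim_pi=> f; elim/elim_pi=> g.
by rewrite -dialg_piZ -dialg_piD !pi_vdash vdash_linearr dialg_piD dialg_piZ.
Qed.
Fact quot_dashv_linearl z : linear (quot_dashv^~ z).
Proof.
elim/elim_pi: z => h a; elim/elim_pi=> f; elim/elim_pi=> g.
by rewrite -dialg_piZ -dialg_piD !pi_dashv dashv_linearl dialg_piD dialg_piZ.
Qed.
Fact quot_dashv_linearr z : linear (quot_dashv z).
Proof.
elim/elim_pi: z => h a; elim/elim_pi=> f; elim/elim_pi=> g.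
by rewrite -dialg_piZ -dialg_piD !pi_dashv dashv_linearr dialg_piD dialg_piZ.
Qed.
Fact quot_vdashA : associative quot_vdash.
Proof.
elim/elim_pi=> f; elim/elim_pi=> g; elim/elim_pi=> h.
by rewrite !pi_vdash vdashA.
Qed.
Fact quot_dashvA : associative quot_dashv.
Proof.
elim/elim_pi=> f; elim/elim_pi=> g; elim/elim_pi=> h.
by rewrite !pi_dashv dashvA.
Qed.
Fact quot_dashv_vdash f g h :
  quot_dashv f (quot_vdash g h) = quot_dashv (quot_dashv f g) h.
Proof.
elim/elim_pi: f => f; elim/elim_pi: g => g; elim/elim_pi: h => h.
by rewrite pi_vdash !pi_dashv dashv_vdash.
Qed.
Fact quot_vdash_dashv f g h :
  quot_vdash (quot_dashv f g) h = quot_vdash (quot_vdash f g) h.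
Proof.
elim/elim_pi: f => f; elim/elim_pi: g => g; elim/elim_pi: h => h.
by rewrite pi_dashv !pi_vdash vdash_dashv.
Qed.
Fact quot_vdashAdashv f g h :
  quot_vdash f (quot_dashv g h) = quot_dashv (quot_vdash f g) h.
Proof.
elim/elim_pi: f => f; elim/elim_pi: g => g; elim/elim_pi: h => h.
by rewrite pi_dashv !pi_vdash pi_dashv vdashAdashv.
Qed.
HB.instance Definition _ := Lmodule_isDialgebra.Build k dialg_quot
  quot_vdash_linearl quot_vdash_linearr quot_dashv_linearl quot_dashv_linearr
  quot_vdashA quot_dashvA quot_dashv_vdash quot_vdash_dashv quot_vdashAdashv.

End QuotientDialgebra.

(* The family (e i) indexed by the i in A is a linear basis of V; as a family,
   so independence forces the e i to be pairwise distinct. *)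
Definition is_basis (k : fieldType) (V : lmodType k) (I : choiceType)
    (A : set I) (e : I -> V) : Prop :=
  (forall (J : {fset I}) (c : I -> k), (forall i, i \in J -> A i) ->
     \sum_(i <- J) c i *: e i = 0 -> forall i, i \in J -> c i = 0) /\
  (forall v : V, exists (J : {fset I}) (c : I -> k),
     (forall i, i \in J -> A i) /\ v = \sum_(i <- J) c i *: e i).

(* Diword [:: x_(-m); ..; x_(-1)] x_0 [:: x_1; ..; x_n] is the normal diword
   x_(-m) ... x_n with center x_0. *)
Record diword (X : Type) :=
  Diword { dw_pre : seq X; dw_ctr : X; dw_post : seq X }.

Section DiwordTheory.
Variable X : Type.
Implicit Types u v : diword X.

Definition diword_tuple u := (dw_pre u, dw_ctr u, dw_post u).
Definition tuple_diword (t : seq X * X * seq X) := Diword t.1.1 t.1.2 t.2.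
Lemma diword_tupleK : cancel diword_tuple tuple_diword.
Proof. by case. Qed.

Definition dw_word u := dw_pre u ++ dw_ctr u :: dw_post u.
Definition dw_size u := size (dw_word u).
Definition dw_letter x : diword X := Diword [::] x [::].
Definition dw_vdash u v :=
  Diword (dw_word u ++ dw_pre v) (dw_ctr v) (dw_post v).
Definition dw_dashv u v :=
  Diword (dw_pre u) (dw_ctr u) (dw_post u ++ dw_word v).
End DiwordTheory.

HB.instance Definition _ (X : eqType) :=
  Equality.copy (diword X) (can_type (@diword_tupleK X)).
HB.instance Definition _ (X : choiceType) :=
  Choice.copy (diword X) (can_type (@diword_tupleK X)).

Fact diword_display : Order.disp_t. Proof. exact: (Order.Disp tt tt). Qed.

Section DiwordOrder.
Context {d : Order.disp_t} {X : orderType d}.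
Implicit Types u v : diword X.

Definition dw_wt u : nat *l (nat *l seqlexi X) :=
  (dw_size u, (size (dw_pre u), dw_word u)).

Lemma dw_wt_inj : injective dw_wt.
Proof.
case=> [a x b] [a' x' b'] [] _ sz /eqP.
by rewrite /dw_word /= eqseq_cat // eqseq_cons => /and3P[/eqP-> /eqP-> /eqP->].
Qed.

Definition dw_le u v := (dw_wt u <= dw_wt v)%O.
Definition dw_lt u v := (dw_wt u < dw_wt v)%O.

Fact dw_lt_def u v : dw_lt u v = (v != u) && dw_le u v.
Proof. by rewrite /dw_lt lt_def (inj_eq dw_wt_inj). Qed.
Fact dw_le_refl : reflexive dw_le.
Proof. by move=> u; apply: lexx. Qed.
Fact dw_le_anti : antisymmetric dw_le.
Proof. by move=> u v /le_anti; apply: dw_wt_inj. Qed.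
Fact dw_le_trans : transitive dw_le.
Proof. by move=> u v w; apply: le_trans. Qed.
Fact dw_le_total : total dw_le.
Proof. by move=> u v; apply: le_total. Qed.

HB.instance Definition _ := Order.isPOrder.Build diword_display (diword X)
  dw_lt_def dw_le_refl dw_le_anti dw_le_trans.
HB.instance Definition _ :=
  Order.POrder_isTotal.Build diword_display (diword X) dw_le_total.

Lemma dw_ltE u v : (u < v)%O = (dw_wt u < dw_wt v)%O.
Proof. by []. Qed.
End DiwordOrder.

Section BilinearExtension.
Context {k : fieldType} {K : choiceType}.
Implicit Types (f g h : {malg k[K]}) (op : K -> K -> K).

Definition malg_bilin op f g : {malg k[K]} :=
  \sum_(u <- msupp f) \sum_(v <- msupp g) << f@_u * g@_v *g op u v >>.

Lemma malg_bilinEw op (D E : {fset K}) f g :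
    (msupp f `<=` D)%fset -> (msupp g `<=` E)%fset ->
  malg_bilin op f g =
    \sum_(u <- D) \sum_(v <- E) << f@_u * g@_v *g op u v >>.
Proof.
move=> sf sg; rewrite /malg_bilin.
rewrite [LHS](big_fset_incl _ sf) => [|u _ /mcoeff_outdom fu0]; last first.
  by rewrite big1 // => v _; rewrite fu0 mul0r monalgU0.
apply: eq_bigr => u _; rewrite (big_fset_incl _ sg) // => v _ /mcoeff_outdom gv0.
by rewrite gv0 mulr0 monalgU0.
Qed.

Lemma malg_bilin_linearl op h : linear ((malg_bilin op)^~ h).
Proof.
move=> a f g /=; pose D := (msupp (a *: f + g) `|` (msupp f `|` msupp g))%fset.
have [sD sf sg] : [/\ msupp (a *: f + g) `<=` D, msupp f `<=` D
    & msupp g `<=` D]%fset.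
  by rewrite /D; split; apply/fsubsetP => x; rewrite !inE => ->; rewrite ?orbT.
rewrite !(@malg_bilinEw _ D (msupp h)) //.
rewrite scaler_sumr -big_split /=; apply: eq_bigr => u _.
rewrite scaler_sumr -big_split /=; apply: eq_bigr => v _.
rewrite mcoeffD mcoeffZ mulrDl -mulrA monalgUD; congr (_ + _).
by apply/malgP => w; rewrite mcoeffZ !mcoeffU mulrnAr.
Qed.

Lemma malg_bilin_linearr op h : linear (malg_bilin op h).
Proof.
move=> a f g /=; pose D := (msupp (a *: f + g) `|` (msupp f `|` msupp g))%fset.
have [sD sf sg] : [/\ msupp (a *: f + g) `<=` D, msupp f `<=` D
    & msupp g `<=` D]%fset.
  by rewrite /D; split; apply/fsubsetP => x; rewrite !inE => ->; rewrite ?orbT.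
rewrite !(@malg_bilinEw _ (msupp h) D) //.
rewrite scaler_sumr -big_split /=; apply: eq_bigr => u _.
rewrite scaler_sumr -big_split /=; apply: eq_bigr => v _.
rewrite mcoeffD mcoeffZ mulrDr mulrCA monalgUD; congr (_ + _).
by apply/malgP => w; rewrite mcoeffZ !mcoeffU mulrnAr.
Qed.

Lemma malg_bilinU op (a b : k) u v :
  malg_bilin op << a *g u >> << b *g v >> = << a * b *g op u v >>.
Proof.
rewrite (malg_bilinEw _ msuppU_le msuppU_le) !big_seq_fset1.
by rewrite !mcoeffUU.
Qed.

HB.instance Definition _ op h := GRing.isLinear.Build k {malg k[K]} {malg k[K]} _
  (malg_bilin op h) (malg_bilin_linearr op h).
Let bl op h f := malg_bilin op f h.
HB.instance Definition _ op h := GRing.isLinear.Build k {malg k[K]} {malg k[K]} _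
  (bl op h) (malg_bilin_linearl op h).

Lemma malg_bilin_sumr op h (I : Type) (r : seq I) (F : I -> {malg k[K]}) :
  malg_bilin op h (\sum_(i <- r) F i) = \sum_(i <- r) malg_bilin op h (F i).
Proof. exact: raddf_sum. Qed.

Lemma malg_bilin_suml op h (I : Type) (r : seq I) (F : I -> {malg k[K]}) :
  malg_bilin op (\sum_(i <- r) F i) h = \sum_(i <- r) malg_bilin op (F i) h.
Proof. exact: (raddf_sum (bl op h)). Qed.

Lemma malg_bilin_assoc op1 op2 op3 op4 :
    (forall u v w, op1 u (op2 v w) = op3 (op4 u v) w) ->
  forall f g h, malg_bilin op1 f (malg_bilin op2 g h) =
                malg_bilin op3 (malg_bilin op4 f g) h.
Proof.
move=> opA f g h; rewrite [f]monalgE !malg_bilin_suml; apply: eq_bigr => u _.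
rewrite [g]monalgE malg_bilin_suml !malg_bilin_sumr malg_bilin_suml.
apply: eq_bigr => v _; rewrite [h]monalgE !malg_bilin_sumr.
apply: eq_bigr => w _.
by rewrite !malg_bilinU opA mulrA.
Qed.
End BilinearExtension.

Section FreeDialgebra.
Variables (k : fieldType) (X : choiceType).

Definition free_dialg := {malg k[diword X]}.
HB.instance Definition _ := GRing.Lmodule.on free_dialg.

Let A4 := @malg_bilin_assoc k (diword X).

Fact dw_vdashA : associative (@dw_vdash X).
Proof. by move=> u v w; rewrite /dw_vdash /dw_word /= -!catA. Qed.
Fact dw_dashvA : associative (@dw_dashv X).
Proof. by move=> u v w; rewrite /dw_dashv /dw_word /= -!catA. Qed.
Fact dw_dashv_vdash (u v w : diword X) :
  dw_dashv u (dw_vdash v w) = dw_dashv (dw_dashv u v) w.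
Proof. by rewrite /dw_dashv /dw_vdash /dw_word /= -!catA. Qed.
Fact dw_vdash_dashv (u v w : diword X) :
  dw_vdash u (dw_vdash v w) = dw_vdash (dw_dashv u v) w.
Proof. by rewrite /dw_dashv /dw_vdash /dw_word /= -!catA /= -!catA. Qed.
Fact dw_vdashAdashv (u v w : diword X) :
  dw_vdash u (dw_dashv v w) = dw_dashv (dw_vdash u v) w.
Proof. by []. Qed.

HB.instance Definition _ := Lmodule_isDialgebra.Build k free_dialg
  (@malg_bilin_linearl _ _ (@dw_vdash X)) (@malg_bilin_linearr _ _ (@dw_vdash X))
  (@malg_bilin_linearl _ _ (@dw_dashv X)) (@malg_bilin_linearr _ _ (@dw_dashv X))
  (A4 dw_vdashA) (A4 dw_dashvA) (A4 dw_dashv_vdash)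
  (fun f g h => etrans (esym (A4 dw_vdash_dashv f g h)) (A4 dw_vdashA f g h))
  (A4 dw_vdashAdashv).

Definition dialg_gen (x : X) : free_dialg := << dw_letter x >>.

End FreeDialgebra.

Section LeadingTerm.
Context {k : fieldType} {d : Order.disp_t} {X : orderType d}.
Implicit Types f : free_dialg k X.

(* None exactly when f = 0. *)
Definition lead f : option (diword X) :=
  foldr (fun u o => Some (if o is Some v then Order.max u v else u)) None
        (enum_fset (msupp f)).

Lemma lead_SomeP f w :
  lead f = Some w <-> w \in msupp f /\ forall u, u \in msupp f -> (u <= w)%O.
Proof.
have maxP s v : foldr (fun u o => Some (if o is Some v then Order.max u v else u))
    None s = Some v <-> v \in s /\ forall u : diword X, u \in s -> (u <= v)%O.
  elim: s v => [|x s IHs] v /=; first by split=> // -[].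
  case E: (foldr _ _ _) => [y|]; last first.
    case: s E {IHs} => // _; split=> [[<-]|[]]; last by rewrite inE => /eqP->.
    by rewrite mem_head; split=> // u; rewrite inE => /eqP->.
  have /IHs[ys yM] := E; split=> [[<-]|[vs vM]].
    split=> [|u]; first by rewrite /Order.max inE; case: ifP; rewrite ?eqxx ?ys ?orbT.
    by rewrite inE le_max => /orP[/eqP->|/yM->]; rewrite ?lexx ?orbT.
  congr Some; apply/le_anti; rewrite ge_max !vM ?inE ?eqxx ?ys ?orbT //=.
  by move: vs; rewrite inE le_max => /orP[/eqP->|/yM->]; rewrite ?lexx ?orbT.
exact: maxP.
Qed.

Lemma lead_NoneP f : lead f = None <-> f = 0.
Proof.
split=> [|->]; last by rewrite /lead msupp0.
rewrite /lead; case E: (enum_fset (msupp f)) => [|//] _.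
apply/malgP => u; rewrite mcoeff0; apply/mcoeff_outdom.
by rewrite -[_ \in _]/(u \in enum_fset (msupp f)) E.
Qed.

Definition osize (o : option (diword X)) : nat := if o is Some u then dw_size u else 0.
Definition olt (o o' : option (diword X)) : Prop :=
  if o is Some u then if o' is Some v then (u < v)%O else False else False.

(* deg 0 is the irrelevant value 0. *)
Definition deg f : nat := osize (lead f).
Definition dialg_monic f : Prop := exists2 w, lead f = Some w & f@_w = 1.
Definition left_normed f : Prop := forall u, u \in msupp f -> dw_post u = [::].
Definition right_normed f : Prop := forall u, u \in msupp f -> dw_pre u = [::].
End LeadingTerm.

(* The expression [a _ b] with a hole at position p, center at position 0:
   p = 0,  SCenter a b    : a ⊢ _ ⊣ b
   p < 0,  SLeft a c x d  : a ⊢ _ ⊢ c ⊢ x ⊣ d, so that b = c x d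
   p > 0,  SRight c x d b : c ⊢ x ⊣ d ⊣ _ ⊣ b, so that a = c x d. *)
Inductive slot (X : Type) :=
  | SCenter of seq X & seq X
  | SLeft of seq X & seq X & X & seq X
  | SRight of seq X & X & seq X & seq X.

Section Slots.
Variable X : Type.

Definition slot_pre (t : slot X) : seq X :=
  match t with
  | SCenter a _ => a
  | SLeft a _ _ _ => a
  | SRight c x d _ => c ++ x :: d
  end.

Definition slot_post (t : slot X) : seq X :=
  match t with
  | SCenter _ b => b
  | SLeft _ c x d => c ++ x :: d
  | SRight _ _ _ b => b
  end.

Variables (T : Type) (vd dv : T -> T -> T) (i : X -> T).

Definition di_expr (l : seq T) (x : T) (r : seq T) : T :=
  foldr vd (foldl dv x r) l.

Definition slot_eval (t : slot X) (s : T) : T :=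
  match t with
  | SCenter a b => di_expr (map i a) s (map i b)
  | SLeft a c x d => di_expr (map i a ++ s :: map i c) (i x) (map i d)
  | SRight c x d b => di_expr (map i c) (i x) (map i d ++ s :: map i b)
  end.
End Slots.

Section GroebnerShirshov.
Context {k : fieldType} {d : Order.disp_t} {X : orderType d}.
Local Notation D := (free_dialg k X).
Implicit Types (s f g h : D) (t : slot X) (w : diword X) (S : set D).

(* [a s b] and [a [lead s] b] *)
Definition sdiword t s : D := slot_eval vdash dashv (@dialg_gen k X) t s.
Definition sdiword_lead t s : option (diword X) :=
  omap (slot_eval (@dw_vdash X) (@dw_dashv X) (@dw_letter X) t) (lead s).

Definition normal_sdiword t s : Prop :=
  match t with
  | SCenter _ _ => True
  | SLeft _ _ _ _ => left_normed s
  | SRight _ _ _ _ => right_normed s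
  end.
Definition left_normed_sdiword t s : Prop :=
  [/\ normal_sdiword t s, left_normed s & left_normed (sdiword t s)].
Definition right_normed_sdiword t s : Prop :=
  [/\ normal_sdiword t s, right_normed s & right_normed (sdiword t s)].

(* h is a finite linear combination of S-diwords [a s b] satisfying P *)
Definition sdiword_comb S (P : slot X -> D -> Prop) h : Prop :=
  exists (n : nat) (a : 'I_n -> k) (t : 'I_n -> slot X) (s : 'I_n -> D),
    h = \sum_(i < n) a i *: sdiword (t i) (s i) /\
    forall i, S (s i) /\ P (t i) (s i).

Definition left_mul_trivial S x f : Prop :=
  sdiword_comb S (fun t s => right_normed_sdiword t s /\
      (osize (sdiword_lead t s) <= deg (dialg_gen k x ⊣ f))%N)
    (dialg_gen k x ⊣ f).
Definition right_mul_trivial S x f : Prop :=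
  sdiword_comb S (fun t s => left_normed_sdiword t s /\
      (osize (sdiword_lead t s) <= deg (f ⊢ dialg_gen k x))%N)
    (f ⊢ dialg_gen k x).

(* Triviality of h modulo (S, [w]), for the composition h of the S-diwords
   [a1 s1 b1] and [a2 s2 b2]. *)
Definition comp_trivial S w t1 s1 t2 s2 h : Prop :=
  sdiword_comb S (fun t s =>
      [/\ normal_sdiword t s, olt (sdiword_lead t s) (Some w),
          right_normed_sdiword t1 s1 /\ right_normed_sdiword t2 s2 ->
            right_normed_sdiword t s
        & left_normed_sdiword t1 s1 /\ left_normed_sdiword t2 s2 ->
            left_normed_sdiword t s]) h.

Record GS_basis S : Prop := IsGSBasis {
  GS_left_mul : forall x f, S f -> ~ right_normed f -> left_mul_trivial S x f;
  GS_right_mul : forall x f, S f -> ~ left_normed f -> right_mul_trivial S x f;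
  GS_inclusion : forall f g w t, S f -> S g ->
    lead f = Some w -> sdiword_lead t g = Some w -> normal_sdiword t g ->
    comp_trivial S w (SCenter [::] [::]) f t g (f - sdiword t g);
  GS_intersection : forall f g w t1 t2, S f -> S g ->
    slot_pre t1 = [::] -> slot_post t2 = [::] ->
    sdiword_lead t1 f = Some w -> sdiword_lead t2 g = Some w ->
    (dw_size w < deg f + deg g)%N ->
    normal_sdiword t1 f -> normal_sdiword t2 g ->
    comp_trivial S w t1 f t2 g (sdiword t1 f - sdiword t2 g)
}.

Definition Irr S : set (diword X) :=
  [set u | forall t s, S s -> normal_sdiword t s -> sdiword_lead t s <> Some u].

Definition dialg_monom (u : diword X) : D := << u >>.

End GroebnerShirshov.

(* Main.v *)
(** Write [t[s]] for the s-diword obtained by putting [s] into the slot [t]. On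
    the diwords admissible for [t] the map [u |-> t[u]] is strictly monotone, so
    a normal S-diword has leading term [t[lead s]].

    Every S-diword is a combination of normal ones: a non-normal one contains a
    composition [x ⊣ s] or [s ⊢ x], and the triviality of that composition
    yields normal S-diwords. Hence Id(S) is spanned by the normal S-diwords.

    Two normal S-diwords with the same leading term [w] differ by a combination
    of normal S-diwords with leading terms below [w]: if the two occurrences of
    the leading words are disjoint, one swaps the lower terms of one factor with
    those of the other; if they overlap, the difference is a composition of
    inclusion or intersection placed in a common slot [T]. When the center
    of [w] is a letter of [T], both polynomials are left (or right) normed, and it is
    the normedness clause of triviality that keeps the result normal.

    Well-founded induction on the largest leading term of a representation of f
    then shows that the leading term of f is that of a normal S-diword. *)
Require Import Defs.
From mathcomp Require Import all_boot all_order all_algebra.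
From mathcomp Require Import boolp classical_sets wochoice.
From HB Require Import structures.
From mathcomp Require Import finmap monalg zify.

Import Order.TTheory GRing.Theory.
Local Open Scope classical_set_scope.
Local Open Scope ring_scope.

(** * Filling slots with diwords, and composing slots *)

Section Slots.
Set Implicit Arguments.
Unset Strict Implicit.
Variable X : Type.
Implicit Types (u v w : diword X) (t T : slot X).

(** Closed form of [slot_eval] on diwords. In a side slot the center of [u] is forgotten and only
    its word survives. *)
Definition slot_fill t u : diword X :=
  match t with
  | SCenter a b => Diword (a ++ dw_pre u) (dw_ctr u) (dw_post u ++ b)
  | SLeft a c x d => Diword (a ++ dw_word u ++ c) x d
  | SRight c x d b => Diword c x (d ++ dw_word u ++ b)
  end.

Lemma foldr_dw_vdash l u :
  foldr (@dw_vdash X) u (map (@dw_letter X) l) =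
  Diword (l ++ dw_pre u) (dw_ctr u) (dw_post u).
Proof. by elim: l => [|x l /= ->] //=; case: u. Qed.

Lemma foldl_dw_dashv r u :
  foldl (@dw_dashv X) u (map (@dw_letter X) r) =
  Diword (dw_pre u) (dw_ctr u) (dw_post u ++ r).
Proof.
elim: r u => [|x r IHr] u /=; first by rewrite cats0; case: u.
by rewrite IHr /= -catA.
Qed.

Lemma slot_fillE t u :
  slot_eval (@dw_vdash X) (@dw_dashv X) (@dw_letter X) t u = slot_fill t u.
Proof.
case: t => [a b|a c x d|c x d b]; rewrite /= /di_expr.
- by rewrite foldl_dw_dashv foldr_dw_vdash.
- rewrite foldl_dw_dashv foldr_cat /= foldr_dw_vdash foldr_dw_vdash /=.
  by rewrite cats0.
- rewrite foldl_cat /= foldl_dw_dashv /= foldl_dw_dashv foldr_dw_vdash /=.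
  by rewrite cats0 -catA.
Qed.

(** When the center belongs to [T], only the words flanking the hole of [t] matter, and the center
    chosen in [t] is lost. *)
Definition slot_comp T t : slot X :=
  match T, t with
  | SCenter A B, SCenter a b => SCenter (A ++ a) (b ++ B)
  | SCenter A B, SLeft a c x d => SLeft (A ++ a) c x (d ++ B)
  | SCenter A B, SRight c x d b => SRight (A ++ c) x d (b ++ B)
  | SLeft A C y D, _ => SLeft (A ++ slot_pre t) (slot_post t ++ C) y D
  | SRight C y D B, _ => SRight C y (D ++ slot_pre t) (slot_post t ++ B)
  end.

Lemma dw_word_fill t u : dw_word (slot_fill t u) = slot_pre t ++ dw_word u ++ slot_post t.
Proof. by case: t => *; rewrite /dw_word /= -!catA. Qed.

Lemma slot_fill_comp T t u : slot_fill T (slot_fill t u) = slot_fill (slot_comp T t) u.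
Proof.
by case: T => *; case: t => *; rewrite /= /dw_word /= -?catA ?cat_cons //= -?catA //= -?catA.
Qed.

(* [normal_sdiword t s] says that every diword of s is admissible for t. *)
Definition admissible t u : Prop :=
  match t with
  | SCenter _ _ => True
  | SLeft _ _ _ _ => dw_post u = [::]
  | SRight _ _ _ _ => dw_pre u = [::]
  end.
End Slots.

(** * Monotonicity of slot filling and well-foundedness of the diword order *)

Section DiwordOrder.
Set Implicit Arguments.
Unset Strict Implicit.
Variables (d : Order.disp_t) (X : orderType d).
Implicit Types (u v w : diword X) (t T : slot X) (p q r : seqlexi X).

Lemma ltxi_cat2l p q r : (p ++ q < p ++ r :> seqlexi X)%O = (q < r)%O.
Proof. by elim: p => //= x p IHp; rewrite ltxi_cons lexx /= IHp. Qed.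

Lemma ltxi_cat2r p q r : size p = size q ->
  (p ++ r < q ++ r :> seqlexi X)%O = (p < q)%O.
Proof.
elim: p q => [|x p IHp] [|y q] //=.
by case=> /IHp E; rewrite !ltxi_cons E.
Qed.

Lemma dw_ltP u v : reflect
  [\/ (dw_size u < dw_size v)%N,
      dw_size u = dw_size v /\ (size (dw_pre u) < size (dw_pre v))%N |
      [/\ dw_size u = dw_size v, size (dw_pre u) = size (dw_pre v) &
          (dw_word u < dw_word v :> seqlexi X)%O]] (u < v)%O.
Proof.
rewrite dw_ltE /dw_wt ltxi_pair ltxi_pair !leEnat.
case: (ltngtP (dw_size u) (dw_size v)) => E1 /=; last first.
- case: (ltngtP (size (dw_pre u)) (size (dw_pre v))) => E2 /=.
  + by apply: ReflectT; apply: Or32.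
  + by apply: ReflectF; case=> [|[]|[]]; lia.
  apply: (iffP idP) => [?|]; first by apply: Or33.
  by case=> [|[]|[]] //; lia.
- by apply: ReflectF; case=> [|[]|[]]; lia.
- by apply: ReflectT; apply: Or31.
Qed.

Lemma dw_size_fill t u :
  dw_size (slot_fill t u) = (size (slot_pre t) + dw_size u + size (slot_post t))%N.
Proof. by rewrite /dw_size dw_word_fill !size_cat addnA. Qed.

(** Comparison by length, and by word at equal length, is compatible with concatenation. The
    position of the center is lost in a side slot, but admissibility makes it a function of the
    length, so it never decides the comparison there. *)
Lemma slot_fill_lt t u v : admissible t u -> admissible t v -> (u < v)%O ->
  (slot_fill t u < slot_fill t v)%O.
Proof.
have sizeE w : dw_size w = (size (dw_pre w) + size (dw_post w)).+1.
  by rewrite /dw_size /dw_word size_cat /= addnS.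
have wordE (E : dw_size u = dw_size v) :
    (dw_word (slot_fill t u) < dw_word (slot_fill t v) :> seqlexi X)%O =
    (dw_word u < dw_word v :> seqlexi X)%O.
  by rewrite !dw_word_fill ltxi_cat2l ltxi_cat2r.
move=> tu tv uv; apply/dw_ltP; rewrite !dw_size_fill.
case: t tu tv wordE => [a b|a c x d'|c x d' b] tu tv wordE; rewrite /= !size_cat.
- case/dw_ltP: uv => [E|[E E']|[E E' L]].
  + by apply: Or31; lia.
  + by apply: Or32; lia.
  + by apply: Or33; rewrite wordE //; split; lia.
- rewrite -!/(dw_size _) !sizeE tu tv.
  case/dw_ltP: uv; rewrite !sizeE tu tv /=.
  + by move=> E; apply: Or31; lia.
  + by case=> ? ?; apply: Or31; lia.
  + by case=> E ? L; apply: Or33; rewrite wordE ?sizeE ?tu ?tv //; split; lia.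
- case/dw_ltP: uv => [E|[E E']|[E E' L]].
  + by apply: Or31; lia.
  + by move: E'; rewrite tu tv.
  + by apply: Or33; rewrite wordE //; split; lia.
Qed.

Lemma dw_lt_wf : well_order (<=%O : rel X) -> well_founded (fun u v => (u < v)%O).
Proof.
move=> woX.
have wfX : well_founded (fun x y : X => (x < y)%O).
  move=> x; apply: contrapT => nAx.
  have [|z [[/asboolP nAz zmin] _]] := woX [pred x | `[< ~ Acc (fun x y : X => (x < y)%O) x >]].
    by exists x; apply/asboolP.
  apply: nAz; constructor=> y yz; apply: contrapT => nAy.
  by have := zmin y (asboolT nAy); rewrite leNgt yz.
(* The length is fixed because the lexicographic order on all words need not be well founded. *)
have wfW n : forall p : seqlexi X, size p = n ->
    Acc (fun p q : seqlexi X => size p = n /\ (p < q)%O) p.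
  elim: n => [|n IHn].
    move=> p /size0nil p0; constructor=> q [/size0nil q0].
    by rewrite (_ : q = p) ?ltxx // q0 p0.
  case=> [//|x p] [pn].
  elim: {x}(wfX x) p pn => x _ IHx p pn.
  elim: {p pn}(IHn p pn) => p _ IHp.
  constructor=> -[|y q] [qn]; first by discriminate qn.
  case: qn => qn; rewrite ltxi_cons => /andP[].
  rewrite le_eqVlt => /orP[/eqP ->|yx _]; last exact: IHx.
  by rewrite lexx implyTb => qp; exact: (IHp q (conj qn qp)).
(* One nested induction for each component of the weight. *)
suff accP n m p u : dw_size u = n -> size (dw_pre u) = m -> dw_word u = p ->
    Acc (fun u v : diword X => (u < v)%O) u by move=> u; apply: accP.
elim/ltn_ind: n m p u => n IHn; elim/ltn_ind=> m IHm p u un um up.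
have pn : Acc (fun p q : seqlexi X => size p = n /\ (p < q)%O) p.
  by apply: wfW; rewrite -up.
elim: pn u un um up => {}p _ IHp u un um up.
constructor=> v /dw_ltP[vu|[vu vu']|[vu vu' L]].
- by apply: (IHn (dw_size v)) => //; rewrite -un.
- by apply: (IHm (size (dw_pre v))); rewrite -?um ?vu.
- apply: (IHp (dw_word v) (conj (etrans vu un) _) v _ _ erefl).
  + by rewrite -up.
  + by rewrite vu.
  + by rewrite vu'.
Qed.
End DiwordOrder.

Lemma monalgUZ (k : fieldType) (K : choiceType) (a : k) (u : K) :
  << a *g u >> = a *: << u >> :> {malg k[K]}.
Proof.
apply/malgP => v; rewrite mcoeffZ [LHS]mcoeffU [X in _ = _ * X]mcoeffU.
by rewrite mulrnAr mulr1.
Qed.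

(** * Linearity, supports and leading terms of s-diwords *)

Section Sdiwords.
Set Implicit Arguments.
Unset Strict Implicit.
Variables (k : fieldType) (d : Order.disp_t) (X : orderType d).
Local Notation D := (free_dialg k X).
Implicit Types (u v w : diword X) (t T : slot X) (s f g h : D) (S : set D).

Lemma dialg_coeffZ a f w : (a *: f)@_w = a * f@_w.
Proof. exact: mcoeffZ. Qed.

Lemma foldr_vdash_linear (l : seq D) : linear (fun f => foldr vdash f l).
Proof. by elim: l => [|x l IHl] a f g //=; rewrite IHl vdash_linearr. Qed.

Lemma foldl_dashv_linear (r : seq D) : linear (fun f => foldl dashv f r).
Proof. by elim: r => [|x r IHr] a f g //=; rewrite dashv_linearl IHr. Qed.

Lemma sdiword_linear t : linear (@sdiword k d X t).
Proof.
case: t => [a b|a c x e|c x e b] c0 f g; rewrite /sdiword /= /di_expr.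
- by rewrite foldl_dashv_linear foldr_vdash_linear.
- by rewrite !foldr_cat /= vdash_linearl foldr_vdash_linear.
- by rewrite !foldl_cat /= dashv_linearr foldl_dashv_linear foldr_vdash_linear.
Qed.

HB.instance Definition _ t := GRing.isLinear.Build k D D _ (@sdiword k d X t)
  (sdiword_linear t).

Lemma vdashU u v : (<< u >> : D) ⊢ << v >> = << dw_vdash u v >>.
Proof. by rewrite [LHS]malg_bilinU mulr1. Qed.

Lemma dashvU u v : (<< u >> : D) ⊣ << v >> = << dw_dashv u v >>.
Proof. by rewrite [LHS]malg_bilinU mulr1. Qed.

(** On basis elements the two products are those of diwords, so evaluating a slot amounts to filling
    it; linearity then reduces questions about s-diwords to diwords. *)
Lemma sdiwordU t u : sdiword t (<< u >> : D) = << slot_fill t u >>.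
Proof.
have foldrU (l : seq (diword X)) v :
    foldr vdash (<< v >> : D) (map (fun u => << u >> : D) l) = << foldr (@dw_vdash X) v l >>.
  by elim: l => [//|x l IHl] /=; rewrite IHl vdashU.
have foldlU (r : seq (diword X)) v :
    foldl dashv (<< v >> : D) (map (fun u => << u >> : D) r) = << foldl (@dw_dashv X) v r >>.
  by elim: r v => [//|x r IHr] v /=; rewrite dashvU IHr.
have genE (l : seq X) : map (@dialg_gen k X) l =
    map (fun u => << u >> : D) (map (@dw_letter X) l) by rewrite -map_comp.
rewrite -slot_fillE; case: t => [a b|a c x e|c x e b]; rewrite /sdiword /= /di_expr.
- by rewrite !genE foldlU foldrU.
- rewrite !genE -[X in _ ++ X](map_cons (fun u => << u >> : D) u).
  by rewrite -map_cat -/(<< dw_letter x >>) foldlU foldrU.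
- rewrite !genE -[X in _ ++ X](map_cons (fun u => << u >> : D) u).
  by rewrite -map_cat foldlU foldrU.
Qed.

Lemma sdiwordE t f :
  sdiword t f = \sum_(u <- msupp f) f@_u *: (<< slot_fill t u >> : D).
Proof.
rewrite {1}[f]monalgE raddf_sum; apply: eq_bigr => u _ /=.
have -> : << f@_u *g u >> = f@_u *: << u >> :> D.
  exact: monalgUZ.
by rewrite linearZ /= sdiwordU.
Qed.

Lemma sdiword_comp T t f : sdiword T (sdiword t f) = sdiword (slot_comp T t) f.
Proof.
rewrite [sdiword t f]sdiwordE [RHS]sdiwordE raddf_sum; apply: eq_bigr => u _ /=.
by rewrite linearZ /= sdiwordU slot_fill_comp.
Qed.

Lemma mcoeff_sdiword t f w :
  (sdiword t f)@_w = \sum_(u <- msupp f) f@_u * (slot_fill t u == w)%:R.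
Proof.
rewrite sdiwordE raddf_sum; apply: eq_bigr => u _ /=.
by rewrite dialg_coeffZ mcoeffU.
Qed.

Lemma msupp_sdiword t f w :
  w \in msupp (sdiword t f) -> exists2 u, u \in msupp f & w = slot_fill t u.
Proof.
move=> wf; apply: contrapT => nw; move: wf.
rewrite -mcoeff_neq0 mcoeff_sdiword big1_seq ?eqxx // => u /= uf.
by case: eqP => [E|]; rewrite ?mulr0 //; case: nw; exists u.
Qed.

Lemma normal_sdiwordP t s :
  normal_sdiword t s <-> forall u, u \in msupp s -> admissible t u.
Proof. by case: t. Qed.

Lemma sdiword_leadE t s : sdiword_lead t s = omap (slot_fill t) (lead s).
Proof. by rewrite /sdiword_lead; case: lead => //= u; rewrite slot_fillE. Qed.

(** By strict monotonicity every other diword of [s] is sent strictly below [slot_fill t l], so the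
    leading coefficient cannot be altered. *)
Lemma lead_sdiword t s l : normal_sdiword t s -> lead s = Some l ->
  lead (sdiword t s) = Some (slot_fill t l) /\ (sdiword t s)@_(slot_fill t l) = s@_l.
Proof.
move=> /normal_sdiwordP ts /lead_SomeP[ls lmax].
have fillW u : u \in msupp s -> u != l -> (slot_fill t u < slot_fill t l)%O.
  move=> us nul; apply: slot_fill_lt; [exact: ts | exact: ts |].
  by rewrite lt_neqAle nul lmax.
have cE : (sdiword t s)@_(slot_fill t l) = s@_l.
  rewrite mcoeff_sdiword (big_fsetD1 l) //= eqxx mulr1 big1_seq ?addr0 // => u.
  rewrite /= !inE => /andP[nul us].
  by rewrite lt_eqF ?mulr0 // fillW.
split=> //; apply/lead_SomeP; split; first by rewrite -mcoeff_neq0 cE mcoeff_neq0.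
move=> w /msupp_sdiword[u us ->]; have [->//|nul] := eqVneq u l.
exact/ltW/fillW.
Qed.
End Sdiwords.

(** * Closure properties of linear combinations of S-diwords *)

Section Combinations.
Set Implicit Arguments.
Unset Strict Implicit.
Variables (k : fieldType) (d : Order.disp_t) (X : orderType d).
Local Notation D := (free_dialg k X).
Implicit Types (u v w : diword X) (t T : slot X) (s f g h : D) (S : set D).
Implicit Types (P Q : slot X -> D -> Prop).

Lemma sdiword_comb0 S P : sdiword_comb S P 0.
Proof.
exists 0%N, (fun _ => 0), (fun _ => SCenter [::] [::]), (fun _ => 0).
by split=> [|[]]; rewrite ?big_ord0.
Qed.

Lemma sdiword_combS S P a t s h : S s -> P t s ->
  sdiword_comb S P h -> sdiword_comb S P (a *: sdiword t s + h).
Proof.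
move=> Ss Pts [n [b [tt [ss [-> H]]]]].
(* [unlift ord0] sends index 0 to the new term and each shifted index back to the old family. *)
exists n.+1, (fun i => oapp b a (unlift ord0 i)), (fun i => oapp tt t (unlift ord0 i)),
  (fun i => oapp ss s (unlift ord0 i)); split.
  rewrite big_ord_recl unlift_none; apply: congr1.
  by apply: eq_bigr => i _; rewrite liftK.
by move=> i; case: unliftP => [j|] _ /=.
Qed.

Lemma sdiword_comb_ind S P (R : D -> Prop) : R 0 ->
  (forall a t s h, S s -> P t s -> sdiword_comb S P h -> R h ->
    R (a *: sdiword t s + h)) ->
  forall h, sdiword_comb S P h -> R h.
Proof.
move=> R0 RS h [n [a [t [s [-> H]]]]].
(* [RS] needs the tail to be a combination itself, so both facts are carried through the
   induction. *)
suff [] : R (\sum_(i < n) a i *: sdiword (t i) (s i)) /\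
  sdiword_comb S P (\sum_(i < n) a i *: sdiword (t i) (s i)) by [].
elim: n => [|n IHn] in a t s H *.
  by rewrite big_ord0; split; [|exact: sdiword_comb0].
rewrite big_ord_recl; have [H1 H2] := H ord0.
have [IH1 IH2] := IHn (fun i => a (lift ord0 i)) (fun i => t (lift ord0 i))
  (fun i => s (lift ord0 i)) (fun i => H (lift ord0 i)).
by split; [exact: RS|exact: sdiword_combS].
Qed.

Lemma sdiword_comb1 S P t s : S s -> P t s -> sdiword_comb S P (sdiword t s).
Proof.
move=> Ss Pts; rewrite -[sdiword t s]addr0 -[sdiword t s]scale1r.
exact: sdiword_combS (sdiword_comb0 S P).
Qed.

Lemma sdiword_combD S P g h :
  sdiword_comb S P g -> sdiword_comb S P h -> sdiword_comb S P (g + h).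
Proof.
move=> + Hh; elim/sdiword_comb_ind: g / => [|a t s g Ss Pts _ IH].
  by rewrite add0r.
by rewrite -addrA; apply: sdiword_combS.
Qed.

Lemma sdiword_combZ S P a h : sdiword_comb S P h -> sdiword_comb S P (a *: h).
Proof.
elim/sdiword_comb_ind: h / => [|b t s g Ss Pts _ IH].
  by rewrite scaler0; exact: sdiword_comb0.
by rewrite scalerDr scalerA; apply: sdiword_combS.
Qed.

Lemma sdiword_combN S P h : sdiword_comb S P h -> sdiword_comb S P (- h).
Proof. by rewrite -scaleN1r; apply: sdiword_combZ. Qed.

Lemma sdiword_comb_sum S P (I : eqType) (r : seq I) (F : I -> D) :
  (forall i, i \in r -> sdiword_comb S P (F i)) -> sdiword_comb S P (\sum_(i <- r) F i).
Proof.
elim: r => [|i r IHr] H; first by rewrite big_nil; exact: sdiword_comb0.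
rewrite big_cons; apply: sdiword_combD; first by apply: H; rewrite mem_head.
by apply: IHr => j jr; apply: H; rewrite inE jr orbT.
Qed.

Lemma sdiword_combB S P g h :
  sdiword_comb S P g -> sdiword_comb S P h -> sdiword_comb S P (g - h).
Proof. by move=> Hg Hh; apply: sdiword_combD => //; apply: sdiword_combN. Qed.

Lemma sdiword_comb_lin S P (I : eqType) (r : seq I) (a : I -> k) (t : I -> slot X) s :
  S s -> (forall i, i \in r -> P (t i) s) ->
  sdiword_comb S P (\sum_(i <- r) a i *: sdiword (t i) s).
Proof.
move=> Ss H; apply: sdiword_comb_sum => i ir.
by apply: sdiword_combZ; apply: sdiword_comb1 => //; apply: H.
Qed.

Lemma sdiword_comb_plug S P Q T h : sdiword_comb S P h ->
  (forall t s, S s -> P t s -> Q (slot_comp T t) s) ->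
  sdiword_comb S Q (sdiword T h).
Proof.
move=> + PQ; elim/sdiword_comb_ind: h / => [|a t s g Ss Pts _ IH].
  by rewrite linear0; exact: sdiword_comb0.
by rewrite sdiword_linear sdiword_comp; apply: sdiword_combS => //; exact: PQ.
Qed.

Lemma sdiword_combW S P Q h :
  (forall t s, S s -> P t s -> Q t s) -> sdiword_comb S P h -> sdiword_comb S Q h.
Proof.
move=> PQ [n [a [t [s [-> H]]]]]; exists n, a, t, s; split=> // i.
by have [? ?] := H i; split=> //; apply: PQ.
Qed.
End Combinations.

(** * Id(S) as the span of the normal S-diwords *)

Section NormalSpan.
Set Implicit Arguments.
Unset Strict Implicit.
Variables (k : fieldType) (d : Order.disp_t) (X : orderType d).
Local Notation D := (free_dialg k X).
Implicit Types (u v w : diword X) (t T : slot X) (s f g h : D) (S : set D).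

Lemma linear_malgE (phi : D -> D) f : linear phi ->
  phi f = \sum_(u <- msupp f) f@_u *: phi << u >>.
Proof.
move=> phiL; rewrite {1}[f]monalgE.
apply: (big_rec2 (fun x y : D => phi x = y)) => [|u y x _ <-].
  (* [phi 0 = 0] comes from writing 0 as [-1 *: 0 + 0]. *)
  by rewrite -[0 in LHS](addNr 0) -scaleN1r phiL scaleN1r addNr.
by rewrite monalgUZ phiL.
Qed.

Lemma eq_linear_malg (phi psi : D -> D) : linear phi -> linear psi ->
  (forall u, phi << u >> = psi << u >>) -> phi =1 psi.
Proof.
move=> phiL psiL E f; rewrite (linear_malgE f phiL) (linear_malgE f psiL).
by apply: eq_bigr => u _; rewrite E.
Qed.

(** Here and in the next three lemmas, the slot is an [SCenter] when the product keeps the center of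
    [f], and a side slot holding the center of [u] otherwise. *)
Lemma vdashUl u f : (<< u >> : D) ⊢ f = sdiword (SCenter (dw_word u) [::]) f.
Proof.
move: f; apply: eq_linear_malg => [||v]; [exact: vdash_linearr | exact: sdiword_linear |].
by rewrite vdashU sdiwordU /= cats0.
Qed.

Lemma dashvUl u f : (<< u >> : D) ⊣ f =
  sdiword (SRight (dw_pre u) (dw_ctr u) (dw_post u) [::]) f.
Proof.
move: f; apply: eq_linear_malg => [||v]; [exact: dashv_linearr | exact: sdiword_linear |].
by rewrite dashvU sdiwordU /= cats0.
Qed.

Lemma vdashUr u f : f ⊢ (<< u >> : D) =
  sdiword (SLeft [::] (dw_pre u) (dw_ctr u) (dw_post u)) f.
Proof.
move: f; apply: eq_linear_malg => [||v]; [exact: vdash_linearl | exact: sdiword_linear |].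
by rewrite vdashU sdiwordU.
Qed.

Lemma dashvUr u f : f ⊣ (<< u >> : D) = sdiword (SCenter [::] (dw_word u)) f.
Proof.
move: f; apply: eq_linear_malg => [||v]; [exact: dashv_linearl | exact: sdiword_linear |].
by rewrite dashvU sdiwordU.
Qed.

Lemma ideal_sdiword (I : set D) t f : is_ideal I -> I f -> I (sdiword t f).
Proof.
move=> idI If.
have foldrI (l : seq D) g : I g -> I (foldr vdash g l).
  by move=> Ig; elim: l => //= x l; apply: (ideal_vdashl idI).
have foldlI (r : seq D) g : I g -> I (foldl dashv g r).
  by elim: r g => //= x r IHr g Ig; apply: IHr; apply: (ideal_dashvr idI).
case: t => [a b|a c x e|c x e b]; rewrite /sdiword /= /di_expr.
- exact/foldrI/foldlI.
- by rewrite foldr_cat /=; apply/foldrI/(ideal_vdashr idI).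
- by rewrite foldl_cat /=; apply/foldrI/foldlI/(ideal_dashvl idI).
Qed.

(* A non-normal s-diword contains a composition of left or right multiplication
   x ⊣ s or s ⊢ x; the normed diwords replacing it stay normal in the
   surrounding slot. *)
Lemma sdiword_normal_comb S t s : GS_basis S -> S s ->
  sdiword_comb S (@normal_sdiword k d X) (sdiword t s).
Proof.
move=> gsS Ss; have [nts|nts] := pselect (normal_sdiword t s).
  exact: sdiword_comb1.
case: t nts => [a b|a c x e|c x e b] nts; first by case: nts.
- have plugL T y : match T with SRight _ _ _ _ => False | _ => True end ->
      sdiword_comb S (@normal_sdiword k d X)
        (sdiword (slot_comp T (SLeft [::] [::] y [::])) s).
    move=> Tl; rewrite -sdiword_comp -(vdashUr (dw_letter y)).
    apply: sdiword_comb_plug (GS_right_mul gsS y Ss nts) _ => t' s' _ [[n1 n2 _] _].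
    by case: T Tl => [A B|A C z E|//] _; [case: t' n1 | ].
  (* The letter next to the hole enters the composition: the center [x] if [c] is empty, the first
     letter of [c] otherwise. *)
  case: c nts => [|y c] _.
    by have := plugL (SCenter a e) x I; rewrite /= cats0.
  by have := plugL (SLeft a c x e) y I; rewrite /= cats0.
- have plugR T y : match T with SLeft _ _ _ _ => False | _ => True end ->
      sdiword_comb S (@normal_sdiword k d X)
        (sdiword (slot_comp T (SRight [::] y [::] [::])) s).
    move=> Tl; rewrite -sdiword_comp -(dashvUl (dw_letter y)).
    apply: sdiword_comb_plug (GS_left_mul gsS y Ss nts) _ => t' s' _ [[n1 n2 _] _].
    by case: T Tl => [A B|//|A z C E] _; [case: t' n1 | ].
  case/lastP: e nts => [|e y] _.
    by have := plugR (SCenter c b) x I; rewrite /= cats0.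
  by have := plugR (SRight c x e b) y I; rewrite /= cats1.
Qed.

(** The combinations of normal S-diwords form an ideal containing [S]. For closure under products,
    linearity allows the other factor to be a basis element; the product then fills a slot, and
    [sdiword_normal_comb] restores normality. *)
Lemma gen_ideal_normal_comb S f : GS_basis S -> gen_ideal S f ->
  sdiword_comb S (@normal_sdiword k d X) f.
Proof.
move=> gsS; apply; last first.
  move=> s Ss; suff -> : s = sdiword (SCenter [::] [::]) s by apply: sdiword_comb1.
  by [].
have slotP t f' : sdiword_comb S (@normal_sdiword k d X) f' ->
    sdiword_comb S (@normal_sdiword k d X) (sdiword t f').
  elim/sdiword_comb_ind => [|a t' s h Ss _ _ IH].
    by rewrite linear0; exact: sdiword_comb0.
  rewrite sdiword_linear sdiword_comp; apply: sdiword_combD => //.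
  exact/sdiword_combZ/sdiword_normal_comb.
have sumP (phi : D -> D) g : linear phi ->
    (forall u, sdiword_comb S (@normal_sdiword k d X) (phi << u >>)) ->
    sdiword_comb S (@normal_sdiword k d X) (phi g).
  move=> phiL H; rewrite (linear_malgE g phiL); apply: sdiword_comb_sum => u _.
  exact/sdiword_combZ/H.
split=> [|g h|a g|g h Hg|g h Hg|g h Hg|g h Hg].
- exact: sdiword_comb0.
- exact: sdiword_combD.
- exact: sdiword_combZ.
- apply: (sumP (vdash^~ g)) => [|u]; first exact: vdash_linearl.
  by rewrite vdashUl; apply: slotP.
- apply: (sumP (vdash g)) => [|u]; first exact: vdash_linearr.
  by rewrite vdashUr; apply: slotP.
- apply: (sumP (dashv^~ g)) => [|u]; first exact: dashv_linearl.
  by rewrite dashvUl; apply: slotP.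
- apply: (sumP (dashv g)) => [|u]; first exact: dashv_linearr.
  by rewrite dashvUr; apply: slotP.
Qed.
End NormalSpan.

(** * Relative positions of two factors of a word, and slots preserving normedness *)

Section WordOverlaps.
Set Implicit Arguments.
Unset Strict Implicit.
Variable X : Type.
Implicit Types (a b p q e g h m : seq X).

Lemma cat_eqP a1 q1 a2 q2 : a1 ++ q1 = a2 ++ q2 ->
  (exists e, a2 = a1 ++ e /\ q1 = e ++ q2) \/
  (exists e, a1 = a2 ++ e /\ q2 = e ++ q1).
Proof.
elim: a1 a2 => [|x a1 IHa] [|y a2] /= E.
- by left; exists [::].
- by left; exists (y :: a2).
- by right; exists (x :: a1).
case: E => -> /IHa[[e [-> ->]]|[e [-> ->]]]; by [left; exists e | right; exists e].
Qed.

(** Nonemptiness of [g] yields the strict length bound of an intersection composition; factors that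
    merely touch count as disjoint. *)
Variant overlap a1 p1 b1 a2 p2 b2 : Prop :=
  | OverlapNone m of a2 = a1 ++ p1 ++ m & b1 = m ++ p2 ++ b2
  | OverlapIncl e h of p1 = e ++ p2 ++ h & a2 = a1 ++ e & b2 = h ++ b1
  | OverlapInter e g h of p1 = e ++ g & p2 = g ++ h & (0 < size g)%N &
      a2 = a1 ++ e & b1 = h ++ b2.

Lemma overlapP a1 p1 b1 a2 p2 b2 : a1 ++ p1 ++ b1 = a2 ++ p2 ++ b2 ->
  overlap a1 p1 b1 a2 p2 b2 \/ overlap a2 p2 b2 a1 p1 b1.
Proof.
have wlog_le a1' p1' b1' e p2' b2' : p1' ++ b1' = e ++ p2' ++ b2' ->
    overlap a1' p1' b1' (a1' ++ e) p2' b2' .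
  case/cat_eqP => [[m [-> ->]]|[g [-> E]]]; first exact: OverlapNone.
  case: g E => [|x g] E.
    by apply: (@OverlapNone _ _ _ _ _ _ [::]); rewrite ?cats0 ?E.
  case: (cat_eqP (esym E)) => [[h [-> ->]]|[h [-> ->]]].
    exact: (@OverlapInter _ _ _ _ _ _ e (x :: g) h).
  exact: (@OverlapIncl _ _ _ _ _ _ e h).
case/cat_eqP => [[e [-> E]]|[e [-> E]]]; by [left; apply: wlog_le | right; apply: wlog_le].
Qed.

(** Nothing follows the center of a left slot, so filling it with a left normed diword gives a left
    normed diword; right slots are the mirror image. *)
Definition left_slot (t : slot X) : Prop := match t with
  SCenter _ b => b = [::] | SLeft _ _ _ e => e = [::] | SRight _ _ _ _ => False end.
Definition right_slot (t : slot X) : Prop := match t with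
  SCenter a _ => a = [::] | SLeft _ _ _ _ => False | SRight c _ _ _ => c = [::] end.

(** The center is the last letter of [h], or lies in the hole when [h] is empty. This realizes a
    given overlap of words by slots fit for a normed composition. *)
Lemma left_slot_exists e h :
  exists t : slot X, [/\ left_slot t, slot_pre t = e & slot_post t = h].
Proof.
case/lastP: h => [|h y]; first by exists (SCenter e [::]).
by exists (SLeft e h y [::]); rewrite /= cats1.
Qed.

Lemma right_slot_exists e h :
  exists t : slot X, [/\ right_slot t, slot_pre t = e & slot_post t = h].
Proof.
case: e => [|y e]; first by exists (SCenter [::] h).
by exists (SRight [::] y e h).
Qed.

Lemma dw_post_fill t u : left_slot t -> dw_post u = [::] -> dw_post (slot_fill t u) = [::].
Proof. by case: t => [a b|a c x e|//] /= -> //  ->. Qed.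

Lemma dw_pre_fill t u : right_slot t -> dw_pre u = [::] -> dw_pre (slot_fill t u) = [::].
Proof. by case: t => [a b|//|c x e b] /= -> //  ->. Qed.

(** With the center forced to be the last letter, nothing but the word is left to compare. Thus an
    equality of words inside a side slot, where centers are invisible, becomes the equality of
    diwords that a composition requires. *)
Lemma dw_word_inj_left (u v : diword X) :
  dw_post u = [::] -> dw_post v = [::] -> dw_word u = dw_word v -> u = v.
Proof.
case: u v => [a x b] [a' x' b'] /= -> ->; rewrite /dw_word /= !cats1.
by case/rcons_inj => -> ->.
Qed.

Lemma dw_word_inj_right (u v : diword X) :
  dw_pre u = [::] -> dw_pre v = [::] -> dw_word u = dw_word v -> u = v.
Proof. by case: u v => [a x b] [a' x' b'] /= -> -> [-> ->]. Qed.
End WordOverlaps.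

(** * Differences of S-diwords as combinations with smaller leading terms *)

Lemma sum_fset_swap (k : fieldType) (V : lmodType k) (I : choiceType)
    (A B : {fset I}) (a b : I -> k) (F G : I -> V) i j :
  i \in A -> j \in B -> a i = 1 -> b j = 1 ->
  \sum_(x <- A) a x *: F x = \sum_(x <- B) b x *: G x ->
  F i - G j = \sum_(x <- fsetD B (fset1 j)) b x *: G x -
              \sum_(x <- fsetD A (fset1 i)) a x *: F x.
Proof.
move=> iA jB ai bj; rewrite (big_fsetD1 i) //= (big_fsetD1 j jB) /= ai bj !scale1r.
by move/(canRL (addrK _)) ->; rewrite addrAC [G j + _]addrC addrK.
Qed.

Section SmallDifferences.
Set Implicit Arguments.
Unset Strict Implicit.
Variables (k : fieldType) (d : Order.disp_t) (X : orderType d).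
Local Notation D := (free_dialg k X).
Implicit Types (u v w l : diword X) (t T : slot X) (s f g h : D).
Variable S : set D.
Hypothesis monicS : forall s, S s -> dialg_monic s.

Definition small_comb w : D -> Prop := sdiword_comb S
  (fun t s => normal_sdiword t s /\ olt (sdiword_lead t s) (Some w)).

Lemma lead_coef s l : S s -> lead s = Some l -> s@_l = 1.
Proof. by move=> /monicS[l' -> sl] [<-]. Qed.

Lemma lead_in s l : lead s = Some l -> l \in msupp s.
Proof. by case/lead_SomeP. Qed.

Lemma lead_max s l u : lead s = Some l -> u \in msupp s -> u != l -> (u < l)%O.
Proof. by case/lead_SomeP=> _ M us ul; rewrite lt_neqAle ul M. Qed.

Lemma normal_sdiword_lead t s l : lead s = Some l -> sdiword_lead t s = Some (slot_fill t l).
Proof. by rewrite sdiword_leadE => ->. Qed.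

(* The terms s1(u1) s2(u2) of both sums agree, so the lead terms of one factor
   can be traded for those of the other. *)
Lemma small_disjoint (tau1 tau2 : diword X -> slot X) s1 l1 s2 l2 :
  S s1 -> S s2 -> lead s1 = Some l1 -> lead s2 = Some l2 ->
  (forall u1 u2, slot_fill (tau1 u2) u1 = slot_fill (tau2 u1) u2) ->
  (forall u2, u2 \in msupp s2 -> normal_sdiword (tau1 u2) s1) ->
  (forall u1, u1 \in msupp s1 -> normal_sdiword (tau2 u1) s2) ->
  small_comb (slot_fill (tau1 l2) l1)
    (sdiword (tau1 l2) s1 - sdiword (tau2 l1) s2).
Proof.
move=> S1 S2 L1 L2 E N1 N2.
(* [tau1 u2] is a context with two holes whose second hole is filled with [u2], and [tau2 u1] the
   same context with [u1] in the first; both sums fill it with [s1] and [s2]. *)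
have sumE : \sum_(u2 <- msupp s2) s2@_u2 *: sdiword (tau1 u2) s1 =
            \sum_(u1 <- msupp s1) s1@_u1 *: sdiword (tau2 u1) s2.
  under eq_bigr do rewrite sdiwordE scaler_sumr.
  rewrite exchange_big; apply: eq_bigr => u1 _.
  rewrite sdiwordE scaler_sumr; apply: eq_bigr => u2 _.
  by rewrite !scalerA mulrC E.
rewrite (sum_fset_swap (lead_in L2) (lead_in L1) (lead_coef S2 L2) (lead_coef S1 L1) sumE).
apply: sdiword_combB.
  apply: (@sdiword_comb_lin k d X S _ (diword X) (fsetD (msupp s1) (fset1 l1))
    (fun u => s1@_u) tau2 s2 S2) => u; rewrite in_fsetD1 => /andP[ul us].
  split; first exact: N2.
  rewrite (normal_sdiword_lead _ L2) /= -!E.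
  have /normal_sdiwordP N := N1 _ (lead_in L2).
  by apply: slot_fill_lt; [exact/N|exact/N/lead_in|exact: lead_max L1 us ul].
apply: (@sdiword_comb_lin k d X S _ (diword X) (fsetD (msupp s2) (fset1 l2))
  (fun u => s2@_u) tau1 s1 S1) => u; rewrite in_fsetD1 => /andP[ul us].
split; first exact: N1.
rewrite (normal_sdiword_lead _ L1) /= !E.
have /normal_sdiwordP N := N2 _ (lead_in L1).
by apply: slot_fill_lt; [exact/N|exact/N/lead_in|exact: lead_max L2 us ul].
Qed.

Lemma left_normed_sdiwordI t s : left_slot t -> left_normed s -> left_normed_sdiword t s.
Proof.
move=> lt ls; split=> //; first by case: t lt.
by move=> w /msupp_sdiword[u us ->]; apply: dw_post_fill => //; apply: ls.
Qed.

Lemma right_normed_sdiwordI t s : right_slot t -> right_normed s -> right_normed_sdiword t s.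
Proof.
move=> rt rs; split=> //; first by case: t rt.
by move=> w /msupp_sdiword[u us ->]; apply: dw_pre_fill => //; apply: rs.
Qed.

(* The condition under which compositions of s1 and s2 in t1 and t2 can be
   plugged into T, preserving normality and the order. *)
Definition pluggable T t1 s1 t2 s2 : Prop :=
  match T with
  | SCenter _ _ => True
  | SLeft _ _ _ _ => [/\ left_normed s1, left_normed s2, left_slot t1 & left_slot t2]
  | SRight _ _ _ _ => [/\ right_normed s1, right_normed s2, right_slot t1 & right_slot t2]
  end.

(** For a side slot [T], the normedness clause of triviality makes each replacing term normed, hence
    normal in [T], and makes the diwords admissible, so that filling [T] preserves the order. *)
Lemma small_plug T t1 s1 l1 t2 s2 h : lead s1 = Some l1 -> pluggable T t1 s1 t2 s2 ->
  comp_trivial S (slot_fill t1 l1) t1 s1 t2 s2 h ->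
  small_comb (slot_fill T (slot_fill t1 l1)) (sdiword T h).
Proof.
move=> L1 plT triv; apply: (sdiword_comb_plug triv) => t s Ss [nts + rts lts].
have [l Ls _] := monicS Ss; rewrite !(normal_sdiword_lead _ Ls) /= -slot_fill_comp => lt_l.
have [leadE _] := lead_sdiword nts Ls.
case: T plT => [A B|A c x B|A x c B] plT.
- by split; [case: t nts {lt_l rts lts leadE}|exact: slot_fill_lt].
- case: plT => ln1 ln2 ls1 ls2.
  have [_ lns lnts] := lts (conj (left_normed_sdiwordI ls1 ln1) (left_normed_sdiwordI ls2 ln2)).
  split; first exact: lns.
  apply: slot_fill_lt => //; first by apply: lnts; apply: lead_in.
  by apply: dw_post_fill => //; apply: ln1; apply: lead_in.
- case: plT => rn1 rn2 rs1 rs2.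
  have [_ rns rnts] := rts (conj (right_normed_sdiwordI rs1 rn1) (right_normed_sdiwordI rs2 rn2)).
  split; first exact: rns.
  apply: slot_fill_lt => //; first by apply: rnts; apply: lead_in.
  by apply: dw_pre_fill => //; apply: rn1; apply: lead_in.
Qed.

Hypothesis gsS : GS_basis S.

Lemma small_inclusion T t s1 l1 s2 l2 : S s1 -> S s2 ->
  lead s1 = Some l1 -> lead s2 = Some l2 -> l1 = slot_fill t l2 ->
  normal_sdiword t s2 -> pluggable T (SCenter [::] [::]) s1 t s2 ->
  small_comb (slot_fill T l1) (sdiword T s1 - sdiword (slot_comp T t) s2).
Proof.
move=> S1 S2 L1 L2 E N2 plT.
(* In an inclusion the first polynomial occupies the empty slot, which fixes every diword. *)
have fillE : slot_fill (SCenter [::] [::]) l1 = l1 by case: (l1) => a x b; rewrite /= cats0.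
have L2' := normal_sdiword_lead t L2; rewrite -E in L2'.
have := GS_inclusion gsS S1 S2 L1 L2' N2; rewrite -{1}fillE => /(small_plug L1 plT).
by rewrite fillE -sdiword_comp linearB.
Qed.

Lemma small_intersection T t1 s1 l1 t2 s2 l2 : S s1 -> S s2 ->
  lead s1 = Some l1 -> lead s2 = Some l2 -> slot_pre t1 = [::] -> slot_post t2 = [::] ->
  slot_fill t1 l1 = slot_fill t2 l2 ->
  (dw_size (slot_fill t1 l1) < dw_size l1 + dw_size l2)%N ->
  normal_sdiword t1 s1 -> normal_sdiword t2 s2 -> pluggable T t1 s1 t2 s2 ->
  small_comb (slot_fill T (slot_fill t1 l1))
    (sdiword (slot_comp T t1) s1 - sdiword (slot_comp T t2) s2).
Proof.
move=> S1 S2 L1 L2 pre1 post2 E sz N1 N2 plT.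
have L1' := normal_sdiword_lead t1 L1; have L2' := normal_sdiword_lead t2 L2.
rewrite -E in L2'; have szd : (dw_size (slot_fill t1 l1) < deg s1 + deg s2)%N.
  by rewrite /deg L1 L2.
have := GS_intersection gsS S1 S2 pre1 post2 L1' L2' szd N1 N2.
by move/(small_plug L1 plT); rewrite linearB /= !sdiword_comp.
Qed.
End SmallDifferences.

(** * Comparison of normal S-diwords with equal leading terms, by slot shapes *)

Section EqualLeads.
Set Implicit Arguments.
Unset Strict Implicit.
Variables (k : fieldType) (d : Order.disp_t) (X : orderType d).
Local Notation D := (free_dialg k X).
Implicit Types (u v w l : diword X) (t T : slot X) (s f g h : D) (a b c : seq X).
Variable S : set D.
Hypothesis monicS : forall s, S s -> dialg_monic s.
Hypothesis gsS : GS_basis S.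

Let incl T t := @small_inclusion k d X S monicS gsS T t.
Let inter T t1 := @small_intersection k d X S monicS gsS T t1.

Lemma dw_eta u : u = Diword (dw_pre u) (dw_ctr u) (dw_post u).
Proof. by case: u. Qed.

Lemma dw_sizeE u : dw_size u = (size (dw_pre u) + (size (dw_post u)).+1)%N.
Proof. by rewrite /dw_size size_cat. Qed.

Lemma small_sym w f g : small_comb S w (f - g) -> small_comb S w (g - f).
Proof. by rewrite -(opprB f g); apply: sdiword_combN. Qed.

(** Both holes lie before the common center [x]. Overlapping leading words are matched by left
    slots, and the resulting left normed composition is plugged into an [SLeft]. *)
Lemma small_left_left a1 c1 a2 c2 x e s1 l1 s2 l2 : S s1 -> S s2 ->
  lead s1 = Some l1 -> lead s2 = Some l2 -> left_normed s1 -> left_normed s2 ->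
  overlap a1 (dw_word l1) c1 a2 (dw_word l2) c2 ->
  small_comb S (slot_fill (SLeft a1 c1 x e) l1)
    (sdiword (SLeft a1 c1 x e) s1 - sdiword (SLeft a2 c2 x e) s2).
Proof.
move=> S1 S2 L1 L2 ln1 ln2.
have [p1 p2] : dw_post l1 = [::] /\ dw_post l2 = [::].
  by split; [apply: ln1 | apply: ln2]; apply: lead_in.
case=> [m -> ->|i h E -> ->|i g h E1 E2 g0 -> ->].
- apply: (@small_disjoint _ _ _ _ monicS (fun u2 => SLeft a1 (m ++ dw_word u2 ++ c2) x e)
    (fun u1 => SLeft (a1 ++ dw_word u1 ++ m) c2 x e)) => // u1 u2.
  by rewrite /= -!catA.
- have [t [lt tpre tpost]] := left_slot_exists i h.
  have E' : l1 = slot_fill t l2.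
    by apply: dw_word_inj_left; rewrite ?dw_post_fill ?dw_word_fill ?tpre ?tpost.
  have nt : normal_sdiword t s2 by case: (t) lt.
  have plT : pluggable (SLeft a1 c1 x e) (SCenter [::] [::]) s1 t s2 by [].
  by have := incl S1 S2 L1 L2 E' nt plT; rewrite /= tpre tpost.
- have [t1 [lt1 t1pre t1post]] := left_slot_exists [::] h.
  have [t2 [lt2 t2pre t2post]] := left_slot_exists i [::].
  have E : slot_fill t1 l1 = slot_fill t2 l2.
    apply: dw_word_inj_left; rewrite ?dw_post_fill // !dw_word_fill.
    by rewrite t1pre t1post t2pre t2post E1 E2 /= cats0 -catA.
  have sz : (dw_size (slot_fill t1 l1) < dw_size l1 + dw_size l2)%N.
    have -> : dw_size l2 = (size g + size h)%N by rewrite -size_cat -E2.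
    by rewrite dw_size_fill t1pre t1post /=; lia.
  have nt1 : normal_sdiword t1 s1 by case: (t1) lt1.
  have nt2 : normal_sdiword t2 s2 by case: (t2) lt2.
  have plT : pluggable (SLeft a1 c2 x e) t1 s1 t2 s2 by [].
  have := inter S1 S2 L1 L2 t1pre t2post E sz nt1 nt2 plT.
  rewrite slot_fill_comp /= t1pre t1post t2pre t2post cats0.
  by rewrite (_ : dw_word l1 = i ++ g).
Qed.

(** Mirror image of [small_left_left], with right slots plugged into an [SRight]. *)
Lemma small_right_right c1 x e1 b1 e2 b2 s1 l1 s2 l2 : S s1 -> S s2 ->
  lead s1 = Some l1 -> lead s2 = Some l2 -> right_normed s1 -> right_normed s2 ->
  overlap e1 (dw_word l1) b1 e2 (dw_word l2) b2 ->
  small_comb S (slot_fill (SRight c1 x e1 b1) l1)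
    (sdiword (SRight c1 x e1 b1) s1 - sdiword (SRight c1 x e2 b2) s2).
Proof.
move=> S1 S2 L1 L2 rn1 rn2.
have [p1 p2] : dw_pre l1 = [::] /\ dw_pre l2 = [::].
  by split; [apply: rn1 | apply: rn2]; apply: lead_in.
case=> [m -> ->|i h E -> ->|i g h E1 E2 g0 -> ->].
- apply: (@small_disjoint _ _ _ _ monicS (fun u2 => SRight c1 x e1 (m ++ dw_word u2 ++ b2))
    (fun u1 => SRight c1 x (e1 ++ dw_word u1 ++ m) b2)) => // u1 u2.
  by rewrite /= -!catA.
- have [t [rt tpre tpost]] := right_slot_exists i h.
  have E' : l1 = slot_fill t l2.
    by apply: dw_word_inj_right; rewrite ?dw_pre_fill ?dw_word_fill ?tpre ?tpost.
  have nt : normal_sdiword t s2 by case: (t) rt.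
  have plT : pluggable (SRight c1 x e1 b1) (SCenter [::] [::]) s1 t s2 by [].
  by have := incl S1 S2 L1 L2 E' nt plT; rewrite /= tpre tpost.
- have [t1 [rt1 t1pre t1post]] := right_slot_exists [::] h.
  have [t2 [rt2 t2pre t2post]] := right_slot_exists i [::].
  have E : slot_fill t1 l1 = slot_fill t2 l2.
    apply: dw_word_inj_right; rewrite ?dw_pre_fill // !dw_word_fill.
    by rewrite t1pre t1post t2pre t2post E1 E2 /= cats0 -catA.
  have sz : (dw_size (slot_fill t1 l1) < dw_size l1 + dw_size l2)%N.
    have -> : dw_size l2 = (size g + size h)%N by rewrite -size_cat -E2.
    by rewrite dw_size_fill t1pre t1post /=; lia.
  have nt1 : normal_sdiword t1 s1 by case: (t1) rt1.
  have nt2 : normal_sdiword t2 s2 by case: (t2) rt2.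
  have plT : pluggable (SRight c1 x e1 b2) t1 s1 t2 s2 by [].
  have := inter S1 S2 L1 L2 t1pre t2post E sz nt1 nt2 plT.
  by rewrite slot_fill_comp /= t1pre t1post t2pre t2post cats0.
Qed.

(** The leading words share the center, hence are never disjoint: either [l2] runs past the end of
    [l1], an intersection, or it is included in [l1]. *)
Lemma small_center_center a1 b1 i b2 s1 l1 s2 l2 : S s1 -> S s2 ->
  lead s1 = Some l1 -> lead s2 = Some l2 ->
  dw_pre l1 = i ++ dw_pre l2 -> dw_ctr l1 = dw_ctr l2 ->
  dw_post l1 ++ b1 = dw_post l2 ++ b2 ->
  small_comb S (slot_fill (SCenter a1 b1) l1)
    (sdiword (SCenter a1 b1) s1 - sdiword (SCenter (a1 ++ i) b2) s2).
Proof.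
move=> S1 S2 L1 L2 Epre Ectr /cat_eqP[[h [Epost ->]]|[h [Epost ->]]].
  have E : slot_fill (SCenter [::] h) l1 = slot_fill (SCenter i [::]) l2.
    by rewrite /= cats0 -Epre Ectr -Epost.
  have sz : (dw_size (slot_fill (SCenter [::] h) l1) < dw_size l1 + dw_size l2)%N.
    by rewrite dw_size_fill /= (dw_sizeE l2) Epost size_cat; lia.
  have := @inter (SCenter a1 b2) (SCenter [::] h) _ _ (SCenter i [::]) _ _
    S1 S2 L1 L2 erefl erefl E sz I I I.
  by rewrite slot_fill_comp /= cats0.
have E : l1 = slot_fill (SCenter i h) l2 by rewrite [l1]dw_eta Epre Ectr Epost.
exact: (@incl (SCenter a1 b1) (SCenter i h) _ _ _ _ S1 S2 L1 L2 E I I).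
Qed.

(** The center lies in [l1], so [l2] is to its left: inside [l1], or starting before it and then
    disjoint from [l1] or overlapping its beginning. *)
Lemma small_center_left a1 b1 a2 c x e s1 l1 s2 l2 : S s1 -> S s2 ->
  lead s1 = Some l1 -> lead s2 = Some l2 -> left_normed s2 ->
  slot_fill (SCenter a1 b1) l1 = slot_fill (SLeft a2 c x e) l2 ->
  small_comb S (slot_fill (SCenter a1 b1) l1)
    (sdiword (SCenter a1 b1) s1 - sdiword (SLeft a2 c x e) s2).
Proof.
move=> S1 S2 L1 L2 ln2 [/cat_eqP[[i [-> Epre]]|[i [-> Epre]]] Ectr <-].
  have E : l1 = slot_fill (SLeft i c x (dw_post l1)) l2 by rewrite {1}[l1]dw_eta Epre Ectr.
  exact: (@incl (SCenter a1 b1) (SLeft i c x (dw_post l1)) _ _ _ _ S1 S2 L1 L2 E ln2 I).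
case/cat_eqP: Epre => [[m [Ei Ec]]|[g [Ew Epre]]].
  rewrite {}Ei {}Ec -Ectr; apply: (@small_disjoint _ _ _ _ monicS
    (fun u2 => SCenter (a2 ++ dw_word u2 ++ m) b1)
    (fun u1 => SLeft a2 (m ++ dw_pre u1) (dw_ctr u1) (dw_post u1 ++ b1))) => // u1 u2.
  by rewrite /= -!catA.
(* An empty overlap means that the two words are adjacent, which is again the disjoint case. *)
case: g Ew Epre => [|y g] Ew Epre.
  rewrite /= in Epre; rewrite -[i]cats0 -Ew -Ectr -Epre; apply: (@small_disjoint _ _ _ _ monicS
    (fun u2 => SCenter (a2 ++ dw_word u2) b1)
    (fun u1 => SLeft a2 (dw_pre u1) (dw_ctr u1) (dw_post u1 ++ b1))) => // u1 u2.
  by rewrite /= -!catA.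
(* Here [l2] starts first, so the intersection composition takes [s2] as its first polynomial. *)
apply: small_sym.
have E : slot_fill (SLeft [::] c x (dw_post l1)) l2 = slot_fill (SCenter i [::]) l1.
  by rewrite /= cats0 Epre Ew Ectr -catA.
have sz : (dw_size (slot_fill (SLeft [::] c x (dw_post l1)) l2) < dw_size l2 + dw_size l1)%N.
  by rewrite dw_size_fill /= (dw_sizeE l1) Epre !size_cat /=; lia.
have := @inter (SCenter a2 b1) (SLeft [::] c x (dw_post l1)) _ _ (SCenter i [::]) _ _
  S2 S1 L2 L1 erefl erefl E sz ln2 I I.
by rewrite E slot_fill_comp /= cats0.
Qed.

(** Same case distinction as in [small_center_left], with [l2] to the right of the center; now [l1]
    starts first in the intersection. *)
Lemma small_center_right a1 b1 c x e b2 s1 l1 s2 l2 : S s1 -> S s2 ->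
  lead s1 = Some l1 -> lead s2 = Some l2 -> right_normed s2 ->
  slot_fill (SCenter a1 b1) l1 = slot_fill (SRight c x e b2) l2 ->
  small_comb S (slot_fill (SCenter a1 b1) l1)
    (sdiword (SCenter a1 b1) s1 - sdiword (SRight c x e b2) s2).
Proof.
move=> S1 S2 L1 L2 rn2 [<- Ectr /cat_eqP[[m [-> Eb1]]|[i [Epost Eq]]]].
  rewrite Eb1 -Ectr; apply: (@small_disjoint _ _ _ _ monicS
    (fun u2 => SCenter a1 (m ++ dw_word u2 ++ b2))
    (fun u1 => SRight (a1 ++ dw_pre u1) (dw_ctr u1) (dw_post u1 ++ m) b2)) => // u1 u2.
  by rewrite /= -!catA.
case/cat_eqP: Eq => [[h [Ei ->]]|[h [Ew Eb1]]].
  have E : l1 = slot_fill (SRight (dw_pre l1) x e h) l2.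
    by rewrite {1}[l1]dw_eta /= Epost Ei Ectr.
  exact: (@incl (SCenter a1 b1) (SRight (dw_pre l1) x e h) _ _ _ _ S1 S2 L1 L2 E rn2 I).
case: i Epost Ew => [|y i] Epost Ew.
  rewrite cats0 in Epost; rewrite {}Eb1 -Epost -Ectr -[h]/([::] ++ h) -Ew.
  by apply: (@small_disjoint _ _ _ _ monicS (fun u2 => SCenter a1 (dw_word u2 ++ b2))
    (fun u1 => SRight (a1 ++ dw_pre u1) (dw_ctr u1) (dw_post u1) b2)).
have E : slot_fill (SCenter [::] h) l1 = slot_fill (SRight (dw_pre l1) x e [::]) l2.
  by rewrite /= cats0 Epost Ew Ectr -catA.
have sz : (dw_size (slot_fill (SCenter [::] h) l1) < dw_size l1 + dw_size l2)%N.
  have -> : dw_size l2 = (size (y :: i) + size h)%N by rewrite -size_cat -Ew.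
  by rewrite dw_size_fill /=; lia.
have := @inter (SCenter a1 b2) (SCenter [::] h) _ _ (SRight (dw_pre l1) x e [::]) _ _
  S1 S2 L1 L2 erefl erefl E sz I rn2 I.
by rewrite slot_fill_comp /= Eb1 cats0.
Qed.

(** The center letter separates the two leading words, so they are always disjoint. *)
Lemma small_left_right a c x1 e1 c2 x2 e b s1 l1 s2 l2 : S s1 -> S s2 ->
  lead s1 = Some l1 -> lead s2 = Some l2 -> left_normed s1 -> right_normed s2 ->
  slot_fill (SLeft a c x1 e1) l1 = slot_fill (SRight c2 x2 e b) l2 ->
  small_comb S (slot_fill (SLeft a c x1 e1) l1)
    (sdiword (SLeft a c x1 e1) s1 - sdiword (SRight c2 x2 e b) s2).
Proof.
move=> S1 S2 L1 L2 ln1 rn2 [<- <- ->].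
by apply: (@small_disjoint _ _ _ _ monicS (fun u2 => SLeft a c x1 (e ++ dw_word u2 ++ b))
  (fun u1 => SRight (a ++ dw_word u1 ++ c) x1 e b)).
Qed.

(** The nine pairs of slot shapes reduce to the six lemmas above by exchanging the two S-diwords. *)
Lemma small_sdiwordB t1 s1 l1 t2 s2 l2 w : S s1 -> S s2 ->
  lead s1 = Some l1 -> lead s2 = Some l2 ->
  normal_sdiword t1 s1 -> normal_sdiword t2 s2 ->
  slot_fill t1 l1 = w -> slot_fill t2 l2 = w ->
  small_comb S w (sdiword t1 s1 - sdiword t2 s2).
Proof.
move=> S1 S2 L1 L2 n1 n2 <- /esym E.
case: t1 t2 n1 n2 E => [a1 b1|a1 c1 x1 e1|c1 x1 e1 b1]
  [a2 b2|a2 c2 x2 e2|c2 x2 e2 b2] n1 n2 E.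
- case: (E) => /cat_eqP[[i [-> Epre]]|[i [Ea Epre]]] Ectr Epost.
    by eapply small_center_center; eassumption.
  move/esym: Ectr => Ectr; move/esym: Epost => Epost.
  by apply: small_sym; rewrite E Ea; (eapply small_center_center; eassumption).
- (eapply small_center_left; eassumption).
- (eapply small_center_right; eassumption).
- by apply: small_sym; rewrite E; (move/esym: E => E; eapply small_center_left; eassumption).
- case: (E) => /overlapP[] ov Ex Ee.
    by rewrite -Ex -Ee; eapply small_left_left; eassumption.
  by apply: small_sym; rewrite E Ex Ee; (eapply small_left_left; eassumption).
- (eapply small_left_right; eassumption).
- by apply: small_sym; rewrite E; (move/esym: E => E; eapply small_center_right; eassumption).
- by apply: small_sym; rewrite E; (move/esym: E => E; eapply small_left_right; eassumption).
- case: (E) => Ec Ex /overlapP[] ov.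
    by rewrite -Ec -Ex; eapply small_right_right; eassumption.
  by apply: small_sym; rewrite E Ec Ex; (eapply small_right_right; eassumption).
Qed.
End EqualLeads.

(** * Leading terms of the elements of Id(S) for a Groebner-Shirshov basis *)

Lemma scaler_regroup (R : nzRingType) (V : lmodType R) (a b : R) (x y z : V) :
  a *: (x - y) + (z - b *: y) = (a *: x + z) - (a + b) *: y.
Proof. by rewrite scalerBr scalerDl opprD addrACA. Qed.

Section LeadingTerms.
Set Implicit Arguments.
Unset Strict Implicit.
Variables (k : fieldType) (d : Order.disp_t) (X : orderType d).
Local Notation D := (free_dialg k X).
Implicit Types (u v w l : diword X) (t T : slot X) (s f g h : D).
Variable S : set D.
Hypothesis monicS : forall s, S s -> dialg_monic s.
Hypothesis woX : well_order (<=%O : rel X).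

Lemma dialg_coeffD f g w : (f + g)@_w = f@_w + g@_w.
Proof. exact: mcoeffD. Qed.

Lemma dialg_coeffU u w : (<< u >> : D)@_w = (u == w)%:R.
Proof. exact: mcoeffU. Qed.

Lemma neq0_lead f : f <> 0 -> exists w, lead f = Some w.
Proof.
by case E: (lead f) => [w|] nz; [exists w | case: nz; apply/lead_NoneP].
Qed.

Lemma msupp_lin a f g u : u \in msupp (a *: f + g) -> u \in msupp f \/ u \in msupp g.
Proof.
rewrite -!mcoeff_neq0 dialg_coeffD dialg_coeffZ.
have [->|] := eqVneq f@_u 0; last by left.
by rewrite mulr0 add0r; right.
Qed.

Lemma lead_lin a f g w : a != 0 -> lead f = Some w ->
  (forall u, u \in msupp g -> (u < w)%O) -> lead (a *: f + g) = Some w.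
Proof.
move=> a0 /lead_SomeP[wf fM] gM; apply/lead_SomeP; split; last first.
  by move=> u /msupp_lin[/fM|/gM/ltW].
have gw : g@_w = 0 by apply: mcoeff_outdom; apply/negP => /gM; rewrite ltxx.
by rewrite -mcoeff_neq0 dialg_coeffD dialg_coeffZ gw addr0 mulf_neq0 // mcoeff_neq0.
Qed.

Lemma msupp_reduce f g w u : lead f = Some w -> lead g = Some w -> g@_w = 1 ->
  u \in msupp (- f@_w *: g + f) -> (u < w)%O.
Proof.
move=> /lead_SomeP[_ fM] /lead_SomeP[_ gM] gw us.
have le_uw : (u <= w)%O by case: (msupp_lin us) => [/gM|/fM].
rewrite lt_neqAle le_uw andbT; apply: contraL us => /eqP ->.
by rewrite -mcoeff_eq0 dialg_coeffD dialg_coeffZ gw mulr1 addNr.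
Qed.

Lemma normal_lead t s : S s -> normal_sdiword t s ->
  exists w, [/\ sdiword_lead t s = Some w, lead (sdiword t s) = Some w & (sdiword t s)@_w = 1].
Proof.
move=> Ss nts; have [l Ls sl] := monicS Ss; exists (slot_fill t l).
have [-> ->] := lead_sdiword nts Ls.
by rewrite (normal_sdiword_lead t Ls).
Qed.

Lemma small_supp w h : small_comb S w h -> forall u, u \in msupp h -> (u < w)%O.
Proof.
elim/sdiword_comb_ind: h / => [|a t s h Ss [nts lt_w] _ IH] u.
  by rewrite -mcoeff_neq0 mcoeff0 eqxx.
case/msupp_lin => [us|/IH//]; have [l [Lt /lead_SomeP[_ M] _]] := normal_lead Ss nts.
by move: lt_w; rewrite Lt /=; apply: le_lt_trans; apply: M.
Qed.

Definition le_comb w : D -> Prop := sdiword_comb S (fun t s =>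
  normal_sdiword t s /\ exists2 l, sdiword_lead t s = Some l & (l <= w)%O).

(** The bound is attained by a term satisfying [P], so a strict bound contained in [P] passes to
    [w]; [small_le_comb] relies on this. *)
Lemma le_comb_max (P : slot X -> D -> Prop) f :
  (forall t s, P t s -> normal_sdiword t s) -> sdiword_comb S P f ->
  f = 0 \/ exists2 w, (exists t s, P t s /\ sdiword_lead t s = Some w) & le_comb w f.
Proof.
move=> nP; elim/sdiword_comb_ind: f / => [|a t s f Ss Pts _ IH]; first by left.
right; have [l [Lt _ _]] := normal_lead Ss (nP _ _ Pts).
have le_comb_l : le_comb l (sdiword t s).
  by apply: sdiword_comb1 => //; split; [exact: nP | exists l].
have leW w w' : (w <= w')%O -> forall g, le_comb w g -> le_comb w' g.
  move=> ww' g; apply: sdiword_combW => t' s' _ [n' [l' ? lw]]; split=> //.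
  by exists l' => //; apply: le_trans ww'.
case: IH => [->|[w [t' [s' [Pts' Lw]]] cf]].
  by exists l; [exists t, s | rewrite addr0; apply: sdiword_combZ].
have [lw|wl] := leP l w.
  exists w; first by exists t', s'.
  by apply: sdiword_combD => //; apply: sdiword_combZ; apply: leW le_comb_l.
exists l; first by exists t, s.
by apply: sdiword_combD; [apply: sdiword_combZ | apply: leW cf; apply: ltW].
Qed.

Lemma small_le_comb w f : small_comb S w f ->
  f = 0 \/ exists2 w', (w' < w)%O & le_comb w' f.
Proof.
case/le_comb_max=> [t s [] //|->|[w' [t [s [[_ lt_w] Lw']]] cf]]; first by left.
by right; exists w' => //; move: lt_w; rewrite Lw'.
Qed.

(** Terms with leading term [w] are merged one by one into a single S-diword; each exchange costs
    only a small combination, by [small_sdiwordB]. *)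
Lemma le_comb_split w f : GS_basis S -> le_comb w f -> small_comb S w f \/
  exists a t s, [/\ S s, normal_sdiword t s, sdiword_lead t s = Some w &
    small_comb S w (f - a *: sdiword t s)].
Proof.
move=> gsS; elim/sdiword_comb_ind: f / => [|a t s f Ss [nts [l Ll lw]] _ IH].
  by left; exact: sdiword_comb0.
have [E|ne] := eqVneq l w; last first.
  have small_ts : small_comb S w (a *: sdiword t s).
    apply: sdiword_combZ; apply: sdiword_comb1 => //; split=> //.
    by rewrite Ll /= lt_neqAle ne.
  case: IH => [IH|[b [t' [s' [? ? ? IH]]]]]; first by left; apply: sdiword_combD.
  right; exists b, t', s'; split=> //; rewrite -addrA.
  exact: sdiword_combD.
right; rewrite E {l lw E} in Ll.
case: IH => [IH|[b [t' [s' [Ss' nts' Lw' IH]]]]].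
  by exists a, t, s; split=> //; rewrite addrC addKr.
exists (a + b), t', s'; split; [exact: Ss' | exact: nts' | exact: Lw' |].
have [l Ls _] := monicS Ss; have [l' Ls' _] := monicS Ss'.
move: Ll Lw'; rewrite (normal_sdiword_lead t Ls) (normal_sdiword_lead t' Ls') => -[El] [El'].
have := small_sdiwordB monicS gsS Ss Ss' Ls Ls' nts nts' El El'.
move/(sdiword_combZ a) => H; rewrite /small_comb -scaler_regroup.
exact: sdiword_combD.
Qed.

(** Induction on a bound [w] for the leading terms of a representation. Once the terms at [w] are
    merged, either a nonzero multiple remains and cannot cancel, or the bound drops. *)
Lemma GS_lead f : GS_basis S -> gen_ideal S f -> f <> 0 ->
  exists t s, [/\ S s, normal_sdiword t s & lead f = sdiword_lead t s].
Proof.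
move=> gsS /(gen_ideal_normal_comb gsS) cf.
case: (le_comb_max (P := @normal_sdiword k d X) (fun _ _ => id) cf) => [->//|[w _] {cf}].
elim: w / (dw_lt_wf woX w) f => w _ IH f cf nz.
case: (le_comb_split gsS cf) => [sf|[a [t [s [Ss nts Lw sf]]]]].
  case: (small_le_comb sf) => [//|[w' lt_w cf']].
  exact: IH cf' nz.
have [a0|a0] := eqVneq a 0.
  rewrite a0 scale0r subr0 in sf.
  case: (small_le_comb sf) => [//|[w' lt_w cf']].
  exact: IH cf' nz.
exists t, s; split=> //; have [w' [Lw' Lsd _]] := normal_lead Ss nts.
move: Lsd; move: Lw'; rewrite Lw => -[<-] Lsd.
by have := lead_lin a0 Lsd (small_supp sf); rewrite addrC subrK.
Qed.
End LeadingTerms.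

(** * Equivalence of (ii), (ii)' and (iii) *)

Section Equivalences.
Set Implicit Arguments.
Unset Strict Implicit.
Variables (k : fieldType) (d : Order.disp_t) (X : orderType d).
Local Notation D := (free_dialg k X).
Implicit Types (u v w l : diword X) (t T : slot X) (s f g h : D).
Variable S : set D.
Hypothesis monicS : forall s, S s -> dialg_monic s.
Hypothesis woX : well_order (<=%O : rel X).

Definition leads_normal := forall f, gen_ideal S f -> f <> 0 ->
  exists t s, [/\ S s, normal_sdiword t s & lead f = sdiword_lead t s].

(** Repeating the center in front lengthens [w] by one letter, which supplies the strict bound from
    which the inductions below start. *)
Lemma dw_le_lt_cons u w :
  (u <= w)%O -> (u < Diword (dw_ctr w :: dw_pre w) (dw_ctr w) (dw_post w))%O.
Proof.
move=> le_uw; apply/dw_ltP; apply: Or31.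
have : (dw_size u <= dw_size w)%N.
  move: le_uw; rewrite le_eqVlt => /orP[/eqP ->//|/dw_ltP[/ltnW//|[->]//|[->]//]].
by rewrite !dw_sizeE /=; lia.
Qed.

Lemma in_msuppU u v : (v \in msupp (<< u >> : D)) = (v == u).
Proof.
by rewrite -mcoeff_neq0 dialg_coeffU [v == u]eq_sym; case: (u == v); rewrite ?oner_eq0 ?eqxx.
Qed.

Lemma gen_ideal_lin a f g : gen_ideal S f -> gen_ideal S g -> gen_ideal S (a *: f + g).
Proof.
by have idS := gen_ideal_ideal S; move=> If Ig; apply: (idealD idS) => //; apply: (idealZ idS).
Qed.

Lemma gen_ideal_sdiword t s : S s -> gen_ideal S (sdiword t s).
Proof.
by move=> Ss; apply: (ideal_sdiword t (gen_ideal_ideal S)); exact: (sub_gen_ideal Ss).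
Qed.

Lemma scaler_subK (a : k) f g : a *: g + (- a *: g + f) = f.
Proof. by rewrite addrA -scalerDl subrr scale0r add0r. Qed.

(** The leading term is cancelled by a multiple of a normal S-diword, repeatedly. The bound [w] in
    the conclusion makes the leading terms of the tail fall below that of the new first term. *)
Lemma decreasing_decomposition w f : leads_normal -> gen_ideal S f ->
  (forall u, u \in msupp f -> (u < w)%O) ->
  exists (n : nat) (a : 'I_n -> k) (t : 'I_n -> slot X) (s : 'I_n -> D),
    [/\ f = \sum_(j < n) a j *: sdiword (t j) (s j),
        forall j, S (s j) /\ normal_sdiword (t j) (s j),
        forall j l : 'I_n, (j < l)%N ->
          olt (sdiword_lead (t l) (s l)) (sdiword_lead (t j) (s j)) &
        forall j, olt (sdiword_lead (t j) (s j)) (Some w)].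
Proof.
move=> ii; elim: w / (dw_lt_wf woX w) f => w _ IH f If fw.
have [f0|/eqP nz] := eqVneq f 0.
  exists 0%N, (fun _ => 0), (fun _ => SCenter [::] [::]), (fun _ => 0).
  by split; rewrite ?f0 ?big_ord0 => // -[].
have [t0 [s0 [Ss0 nts0 Lf]]] := ii f If nz.
have [w' [Lts0 Lsd sdw]] := normal_lead monicS Ss0 nts0; rewrite Lts0 in Lf.
have w'w : (w' < w)%O by apply/fw/lead_in.
have [||n [a [t [s [E nts dec lt_w']]]]] := IH w' w'w (- f@_w' *: sdiword t0 s0 + f).
- by apply: gen_ideal_lin => //; apply: gen_ideal_sdiword.
- by move=> u; apply: msupp_reduce.
exists n.+1, (fun i => oapp a f@_w' (unlift ord0 i)),
  (fun i => oapp t t0 (unlift ord0 i)), (fun i => oapp s s0 (unlift ord0 i)); split.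
- rewrite big_ord_recl unlift_none /=.
  under eq_bigr do rewrite liftK /=.
  by rewrite -E scaler_subK.
- by move=> j; case: unliftP => [j'|] _ /=.
- move=> j l; case: (unliftP ord0 l) => [l'|] -> //=.
  case: (unliftP ord0 j) => [j'|] -> /=; first by rewrite /bump /= => jl; apply: dec.
  by move=> _; rewrite Lts0.
- move=> j; case: (unliftP ord0 j) => [j'|] _ /=; last by rewrite Lts0.
  by have := lt_w' j'; case: sdiword_lead => //= u uw'; apply: lt_trans w'w.
Qed.

(** The first term with a nonzero coefficient dominates all later ones; earlier terms vanish and are
    skipped. *)
Lemma decreasing_lead n (a : 'I_n -> k) (t : 'I_n -> slot X) (s : 'I_n -> D) f :
  f = \sum_(j < n) a j *: sdiword (t j) (s j) ->
  (forall j, S (s j) /\ normal_sdiword (t j) (s j)) ->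
  (forall j l : 'I_n, (j < l)%N ->
     olt (sdiword_lead (t l) (s l)) (sdiword_lead (t j) (s j))) ->
  f <> 0 -> exists j, lead f = sdiword_lead (t j) (s j).
Proof.
elim: n => [|n IH] in a t s * => E nts dec nz; first by rewrite big_ord0 in E.
rewrite big_ord_recl in E.
have [a0|a0] := eqVneq (a ord0) 0.
  rewrite a0 scale0r add0r in E.
  have [j Lj] := IH _ _ _ E (fun j => nts (lift ord0 j))
    (fun j j' jj' => dec (lift ord0 j) (lift ord0 j') jj') nz.
  by exists (lift ord0 j).
have [S0 nts0] := nts ord0; have [w [Lw Lsd _]] := normal_lead monicS S0 nts0.
exists ord0; rewrite Lw E; apply: lead_lin => //.
apply: (small_supp monicS).
exists n, (fun j => a (lift ord0 j)), (fun j => t (lift ord0 j)), (fun j => s (lift ord0 j)).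
split=> // j; have [Sj nj] := nts (lift ord0 j); split=> //; split=> //.
by rewrite -Lw; apply: dec.
Qed.

Definition rep_mod_ideal (Q : diword X -> Prop) f := exists g,
  (forall v, v \in msupp g -> Q v) /\ gen_ideal S (f - g).

Lemma rep_mod_ideal_msupp Q f : (forall u, u \in msupp f -> rep_mod_ideal Q << u >>) -> rep_mod_ideal Q f.
Proof.
move=> H; rewrite [f](linear_malgE (phi := id) f) //.
have : {subset enum_fset (msupp f) <= msupp f} by [].
elim: (enum_fset (msupp f)) => [|u r IHr] sr.
  rewrite big_nil; exists 0; split=> [v|]; first by rewrite msupp0.
  by rewrite subr0; apply: ideal0 (gen_ideal_ideal S).
rewrite big_cons.
have [g [Qg Ig]] := H u (sr u (mem_head u r)).
have [g' [Qg' Ig']] := IHr (fun v vr => sr v (mem_behead (s := u :: r) vr)).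
exists (f@_u *: g + g'); split=> [v /msupp_lin[/Qg|/Qg']//|].
have := gen_ideal_lin f@_u Ig Ig'.
by rewrite scalerBr opprD addrACA.
Qed.

(** Subtracting the normal S-diword led by a reducible [v] leaves only diwords below [v], to which
    the induction applies. *)
Lemma rep_mod_ideal_lt u f : (forall v, v \in msupp f -> (v < u)%O) ->
  rep_mod_ideal (fun v => Irr S v /\ (v < u)%O) f.
Proof.
elim: u / (dw_lt_wf woX u) f => u _ IH f fu; apply: rep_mod_ideal_msupp => v vf.
have vu := fu v vf.
have [Iv|nIv] := pselect (Irr S v).
  exists << v >>; rewrite subrr; split; last exact: ideal0 (gen_ideal_ideal S).
  by move=> v'; rewrite in_msuppU => /eqP ->.
have [t [s [Ss nts Lts]]] : exists t s, [/\ S s, normal_sdiword t s & sdiword_lead t s = Some v].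
  apply: contrapT => nts; apply: nIv => t s Ss n Lts; apply: nts.
  by exists t, s.
have [v' [Lv' Lsd sdv]] := normal_lead monicS Ss nts.
move: Lv'; rewrite Lts => -[Ev]; rewrite -Ev in Lsd sdv.
have Lv : lead (<< v >> : D) = Some v.
  by apply/lead_SomeP; rewrite in_msuppU eqxx; split=> // w; rewrite in_msuppU => /eqP ->.
have vv : (<< v >> : D)@_v = 1 by rewrite dialg_coeffU eqxx.
have [|g [Qg Ig]] := IH v vu (- (<< v >> : D)@_v *: sdiword t s + << v >>).
  by move=> w; apply: msupp_reduce.
exists g; split=> [w /Qg[Iw wv]|]; first by split=> //; apply: lt_trans vu.
have := gen_ideal_lin 1 (gen_ideal_sdiword t Ss) Ig.
by rewrite vv scale1r scaleN1r addrA addNKr.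
Qed.

Lemma dialg_pi_sum (I : Type) (r : seq I) (c : I -> k) (e : I -> D) :
  dialg_pi S (\sum_(i <- r) c i *: e i) = \sum_(i <- r) c i *: dialg_pi S (e i).
Proof.
elim: r => [|i r IHr]; last by rewrite !big_cons dialg_piD dialg_piZ IHr.
rewrite !big_nil; apply/dialg_pi_eq0; exact: ideal0 (gen_ideal_ideal S).
Qed.

Lemma mcoeff_sum_monom (J : {fset diword X}) (c : diword X -> k) w :
  (\sum_(i <- J) c i *: (<< i >> : D))@_w = if w \in J then c w else 0.
Proof.
rewrite raddf_sum /=.
under eq_bigr do rewrite dialg_coeffZ dialg_coeffU.
case: ifPn => wJ.
  rewrite (big_fsetD1 w) //= eqxx mulr1 big1_seq ?addr0 // => i.
  by rewrite /= !inE => /andP[/negPf ->]; rewrite mulr0.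
rewrite big1_seq // => i /= iJ; case: eqP => [E|]; rewrite ?mulr0 //.
by move: wJ; rewrite -E iJ.
Qed.

(** A nontrivial relation would be a nonzero element of Id(S) whose leading term is irreducible,
    against (ii). Reduction modulo Id(S) gives spanning. *)
Lemma leads_normal_basis : leads_normal ->
  is_basis (Irr S) (fun u : diword X => dialg_pi S (dialg_monom u) : dialg_quot S).
Proof.
move=> ii; split=> [J c JI E i iJ|v].
  pose f : D := \sum_(i <- J) c i *: (<< i >> : D).
  have If : gen_ideal S f by apply/dialg_pi_eq0; rewrite dialg_pi_sum.
  suff f0 : f = 0 by have := mcoeff_sum_monom J c i; rewrite iJ -/f f0 mcoeff0.
  apply: contrapT => nz; have [t [s [Ss nts Lts]]] := ii f If nz.
  have [w Lw] := neq0_lead nz.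
  have : w \in J.
    move: (lead_in Lw); rewrite -mcoeff_neq0 mcoeff_sum_monom.
    by case: ifP => //; rewrite eqxx.
  by move/JI => /(_ t s Ss nts); rewrite -Lts.
have [g [Qg Ig]] : rep_mod_ideal (Irr S) (dialg_repr v).
  apply: rep_mod_ideal_msupp => u _.
  have [|g [Qg Ig]] := @rep_mod_ideal_lt (Diword (dw_ctr u :: dw_pre u) (dw_ctr u) (dw_post u)) << u >>.
    by move=> u'; rewrite in_msuppU => /eqP ->; apply: dw_le_lt_cons.
  by exists g; split=> // w /Qg[].
exists (msupp g), (fun u => g@_u); split=> //.
rewrite -dialg_pi_sum -[v]dialg_reprK.
by apply/dialg_piP; rewrite -(linear_malgE (phi := id) g).
Qed.

(** If the leading term of [f] were irreducible, reducing the lower terms alone would turn [f] into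
    a nontrivial relation between irreducible diwords. *)
Lemma basis_leads_normal :
  is_basis (Irr S) (fun u : diword X => dialg_pi S (dialg_monom u) : dialg_quot S) ->
  leads_normal.
Proof.
case=> indep _ f If nz; have [w Lw] := neq0_lead nz; rewrite Lw.
apply: contrapT => nts.
have Iw : Irr S w by move=> t s Ss n Lts; apply: nts; exists t, s.
have Lww : lead (<< w >> : D) = Some w.
  by apply/lead_SomeP; rewrite in_msuppU eqxx; split=> // u; rewrite in_msuppU => /eqP ->.
have ww : (<< w >> : D)@_w = 1 by rewrite dialg_coeffU eqxx.
have [g [Qg Ig]] := rep_mod_ideal_lt (fun u => msupp_reduce Lw Lww ww (u := u)).
(* The leading term of [f] is kept and [g] replaces the rest; [g] lies below [w], so the coefficient
   at [w] stays nonzero. *)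
pose h := f@_w *: (<< w >> : D) + g.
have hI u : u \in msupp h -> Irr S u.
  by case/msupp_lin => [|/Qg[]//]; rewrite in_msuppU => /eqP ->.
(* [h] is [f] minus the element of Id(S) provided by [Ig]. *)
have Ih : gen_ideal S h.
  have := gen_ideal_lin (-1) Ig If.
  by rewrite scaleN1r !opprD !opprK scaleNr opprK /h; congr gen_ideal; rewrite addrAC addrNK.
have gw : g@_w = 0 by apply: mcoeff_outdom; apply/negP => /Qg[_]; rewrite ltxx.
have hw : h@_w = f@_w by rewrite dialg_coeffD dialg_coeffZ ww mulr1 gw addr0.
have wh : w \in msupp h by rewrite -mcoeff_neq0 hw mcoeff_neq0 lead_in.
have := indep (msupp h) (fun u => h@_u) hI.
rewrite -dialg_pi_sum -(linear_malgE (phi := id) h) // => /(_ (proj2 (dialg_pi_eq0 _ _) Ih)).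
by move=> /(_ w wh) h0; move: wh; rewrite -mcoeff_neq0 h0 eqxx.
Qed.
End Equivalences.

Theorem theorem3p9 (k : fieldType) (d : Order.disp_t) (X : orderType d)
    (wfX : well_order (<=%O : rel X))
    (S : set (free_dialg k X)) (monicS : forall s, S s -> dialg_monic s) :
  let i := GS_basis S in
  let ii := forall f, gen_ideal S f -> f <> 0 ->
    exists (t : slot X) (s : free_dialg k X),
      [/\ S s, normal_sdiword t s & lead f = sdiword_lead t s] in
  let ii' := forall f, gen_ideal S f ->
    exists (n : nat) (a : 'I_n -> k) (t : 'I_n -> slot X)
           (s : 'I_n -> free_dialg k X),
      [/\ f = \sum_(j < n) a j *: sdiword (t j) (s j),
          forall j, S (s j) /\ normal_sdiword (t j) (s j)
        & forall j l : 'I_n, (j < l)%N ->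
            olt (sdiword_lead (t l) (s l)) (sdiword_lead (t j) (s j))] in
  let iii := is_basis (Irr S)
    (fun u : diword X => dialg_pi S (dialg_monom u) : dialg_quot S) in
  [/\ (i -> ii), (ii <-> ii') & (ii' <-> iii)].
Proof.
move=> i ii ii' iii.
have ii_ii' : ii <-> ii'.
  split=> [Hii f If|Hii' f If nz].
    have [->|/eqP nz] := eqVneq f 0.
      exists 0%N, (fun _ => 0), (fun _ => SCenter [::] [::]), (fun _ => 0).
      by split; rewrite ?big_ord0 => // -[].
    have [w Lw] := neq0_lead nz.
    have [|n [a [t [s [E nts dec _]]]]] := decreasing_decomposition monicS wfX
        (w := Diword (dw_ctr w :: dw_pre w) (dw_ctr w) (dw_post w)) Hii If.
      by case/lead_SomeP: Lw => _ M u /M; apply: dw_le_lt_cons.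
    by exists n, a, t, s.
  have [n [a [t [s [E nts dec]]]]] := Hii' f If.
  have [j Lj] := decreasing_lead monicS E nts dec nz.
  by exists (t j), (s j); have [? ?] := nts j.
split=> //; first by move=> gsS f; exact: GS_lead.
rewrite -ii_ii'; split; first exact: leads_normal_basis.
exact: basis_leads_normal.
Qed.
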